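(* For $(a,b)\in\mathbb{R}^2$, let $H_{(a,b,3)}$ denote the polynomial system $x^{6}+ay^3-y=0$, $y^{6}+bx^3-x=0$, and let $E_3\subseteq\mathbb{R}^2$ be the set of all $(a,b)$ such that $H_{(a,b,3)}$ has at least $5$ non-degenerate isolated roots in the open positive quadrant $\mathbb{R}^2_+=\{(x,y):x>0,\ y>0\}$. Then $E_3$ is non-empty and star convex. In particular, $\left(\frac{44}{31},\frac{44}{31}\right)\in E_3$, and the system $x^6+\frac{44}{31}y^3-y=0,\ y^6+\frac{44}{31}x^3-x=0$ has exactly $5$ roots in $\mathbb{R}^2_+$, all of them non-degenerate.
   Context: A set $S\subset\mathbb{R}^n$ is star convex if there is a point $p\in S$ such that for every $x\in S$ the closed line segment from $p$ to $x$ is contained in $S$. A root of a square polynomial system is non-degenerate if the Jacobian matrix of the system is invertible at that root. *)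

(* Defs.v *)
From Stdlib Require Import Reals List.
From Coquelicot Require Import Coquelicot.
Open Scope R_scope.

Definition H1 (a b x y : R) : R := x ^ 6 + a * y ^ 3 - y.
Definition H2 (a b x y : R) : R := y ^ 6 + b * x ^ 3 - x.

Definition is_root (a b : R) (p : R * R) : Prop :=
  H1 a b (fst p) (snd p) = 0 /\ H2 a b (fst p) (snd p) = 0.

Definition in_pos_quadrant (p : R * R) : Prop := 0 < fst p /\ 0 < snd p.

Definition jacobian_det (a b : R) (p : R * R) : R :=
  let x := fst p in let y := snd p in
  Derive (fun u => H1 a b u y) x * Derive (fun v => H2 a b x v) y
  - Derive (fun v => H1 a b x v) y * Derive (fun u => H2 a b u y) x.

Definition non_degenerate (a b : R) (p : R * R) : Prop := jacobian_det a b p <> 0.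

Definition isolated_root (a b : R) (p : R * R) : Prop :=
  is_root a b p /\
  exists eps, 0 < eps /\ forall q : R * R, is_root a b q ->
    (fst q - fst p) ^ 2 + (snd q - snd p) ^ 2 < eps ^ 2 -> q = p.

Definition E3 (ab : (R * R)%type) : Prop :=
  exists l : Datatypes.list (R * R)%type, NoDup l /\ (5 <= length l)%nat /\
    List.Forall (fun p => in_pos_quadrant p /\ isolated_root (fst ab) (snd ab) p
                     /\ non_degenerate (fst ab) (snd ab) p) l.

Definition star_convex (S : R * R -> Prop) : Prop :=
  exists p, S p /\ forall q, S q -> forall t, 0 <= t <= 1 ->
    S ((1 - t) * fst p + t * fst q, (1 - t) * snd p + t * snd q).

(* Main.v *)
Require Import Defs.
From Stdlib Require Import Reals List.
From Stdlib Require Import Lra Lia.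
From Coquelicot Require Import Coquelicot.
Open Scope R_scope.

(* At a positive root put [X = x^6/y] and [Y = y^6/x]; then [a y^2 = 1 - X], [b x^2 = 1 - Y], and
   the Jacobian determinant is [27XY + 6X + 6Y - 4]. So the degenerate roots form the curve
   [Y = yc X := (4-6X)/(27X+6)], [0 < X < 2/3], with image [(dA X, dB X)] in the [(a, b)]-plane.
   [dA] has three critical points, the cusps [X = (8 -+ 2 sqrt 5)/33] and [X = 2/9], which cut
   the curve into four arcs, each the graph of [b] over [a]; and its slope is decreasing in [X].
   For fixed [a > 0] the roots lie on a curve parametrised by [X] in [(0, 1)] along which [b]
   has at most four critical points. Hence there are at most five roots, and there are five iff
   [(a, b)] lies below arcs 1 and 3 and above arcs 2 and 4; by the symmetry exchanging [a] and
   [b] (which is [X <-> yc X]) the latter says that [(b, a)] lies below arcs 1 and 3.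

   The region has a cusp at [X = 2/9] with the diagonal as tangent, so a centre must lie on the
   diagonal. A centre [(c, c)] works if, on the relevant part of the upper arcs, the tangent
   lines pass above [(c, c)]: then the slope of the chord from [(c, c)] to the arc is monotone.
   The derivative of the height of the tangent at [c] is (derivative of slope) * (c - a), so only
   the end points of the part must be checked; [c = dA (1/13)] is one possible choice. *)

(** * Monotonicity and intermediate values *)

(** The sign condition is on the open interval, so that the ends may be critical points or cusps. *)
Lemma increasing_of_derive (f f' : R -> R) (u v : R) :
  u < v ->
  (forall x, u <= x <= v -> is_derive f x (f' x)) ->
  (forall x, u < x < v -> 0 < f' x) ->
  f u < f v.
Proof.
intros Huv Hd Hp.
destruct (MVT_cor2 f f' u v Huv) as [c [Hc1 Hc2]].
{ intros c Hc. apply is_derive_Reals, Hd, Hc. }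
assert (0 < f' c * (v - u)).
{ apply Rmult_lt_0_compat; [apply Hp; exact Hc2 | lra]. }
lra.
Qed.

Lemma decreasing_of_derive (f f' : R -> R) (u v : R) :
  u < v ->
  (forall x, u <= x <= v -> is_derive f x (f' x)) ->
  (forall x, u < x < v -> f' x < 0) ->
  f v < f u.
Proof.
intros Huv Hd Hp.
destruct (MVT_cor2 f f' u v Huv) as [c [Hc1 Hc2]].
{ intros c Hc. apply is_derive_Reals, Hd, Hc. }
assert (0 < (- f' c) * (v - u)).
{ apply Rmult_lt_0_compat; [specialize (Hp c Hc2); lra | lra]. }
lra.
Qed.

Lemma ivt_incr (f f' : R -> R) (u v w : R) :
  u < v ->
  (forall x, u <= x <= v -> is_derive f x (f' x)) ->
  f u < w < f v ->
  exists x, u < x < v /\ f x = w.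
Proof.
intros Huv Hd Hw.
destruct (Ranalysis5.IVT_interv (fun x => f x - w) u v) as [x [Hx1 Hx2]]; try lra.
- intros x Hx.
  apply continuity_pt_minus; [|apply continuity_pt_const; intros ? ?; reflexivity].
  apply derivable_continuous_pt. exists (f' x).
  apply is_derive_Reals, Hd, Hx.
- exists x. split; [|lra].
  destruct (Req_dec x u) as [->|]; [lra|].
  destruct (Req_dec x v) as [->|]; lra.
Qed.

Lemma ivt_decr (f f' : R -> R) (u v w : R) :
  u < v ->
  (forall x, u <= x <= v -> is_derive f x (f' x)) ->
  f v < w < f u ->
  exists x, u < x < v /\ f x = w.
Proof.
intros Huv Hd Hw.
destruct (ivt_incr (fun x => - f x) (fun x => - f' x) u v (- w)) as [x [Hx1 Hx2]]; try lra.
- intros x Hx. apply (is_derive_opp f). apply Hd, Hx.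
- exists x. split; lra.
Qed.

Lemma rolle (f f' : R -> R) (u v : R) :
  u < v ->
  (forall x, u <= x <= v -> is_derive f x (f' x)) ->
  f u = f v ->
  exists x, u < x < v /\ f' x = 0.
Proof.
intros Huv Hd He.
destruct (MVT_cor2 f f' u v Huv) as [c [Hc1 Hc2]].
{ intros c Hc. apply is_derive_Reals, Hd, Hc. }
exists c. split; [exact Hc2|].
assert (H : f' c * (v - u) = 0) by lra.
apply Rmult_integral in H. lra.
Qed.

(** * The discriminant curve *)

Definition yc (X : R) : R := (4 - 6 * X) / (27 * X + 6).
(** The logarithm of [a] at the degenerate root with parameters [X] and [Y = yc X]: [x^6 = X y] and
    [y^6 = Y x] give [y^35 = X Y^6], and then [a = (1 - X) / y^2]. *)
Definition kap (X : R) : R := ln (1 - X) - 2/35 * ln X - 12/35 * ln (yc X).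
Definition dA (X : R) : R := exp (kap X).
Definition dB (X : R) : R := dA (yc X).
(** The ratio of the logarithmic derivatives of [dB] and [dA]. So [slope] is the slope of the curve
    in the (a, b)-plane with the common factor [dkap] cancelled, and it stays smooth across the
    cusps. *)
Definition sig (X : R) : R := 12 * (1 - X) / (33 * X + 2).
Definition slope (X : R) : R := sig X * dB X / dA X.

Definition cusp1 : R := (8 - 2 * sqrt 5) / 33.
Definition cusp3 : R := (8 + 2 * sqrt 5) / 33.

Lemma cusp_bounds : 1/10 < cusp1 < 11/100 /\ 37/100 < cusp3 < 4/10.
Proof.
assert (H : 0 <= 5) by lra.
pose proof (sqrt_sqrt 5 H) as Hs. pose proof (sqrt_pos 5) as Hp.
unfold cusp1, cusp3. split; nra.
Qed.

Lemma cusp_quadratic (X : R) :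
  99 * X^2 - 48 * X + 4 = 99 * (X - cusp1) * (X - cusp3).
Proof.
assert (H : 0 <= 5) by lra.
pose proof (sqrt_sqrt 5 H) as Hs.
unfold cusp1, cusp3.
replace (99 * (X - (8 - 2 * sqrt 5) / 33) * (X - (8 + 2 * sqrt 5) / 33))
  with (99 * X^2 - 48 * X + (64 - 4 * (sqrt 5 * sqrt 5)) / 11) by field.
rewrite Hs. field.
Qed.

Definition dkap (X : R) : R :=
  (9 * X - 2) * (99 * X^2 - 48 * X + 4) /
  (35 * X * (1 - X) * (9 * X + 2) * (2 - 3 * X)).

Lemma yc_bounds (X : R) : 0 < X < 2/3 -> 0 < yc X < 2/3.
Proof.
intros HX. unfold yc. split.
- apply Rdiv_lt_0_compat; lra.
- apply Rlt_div_l; lra.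
Qed.

Lemma yc_involutive (X : R) : 0 < X < 2/3 -> yc (yc X) = X.
Proof.
intros HX. unfold yc. field. split; lra.
Qed.

Lemma yc_decreasing (X X' : R) : 0 < X -> X < X' -> yc X' < yc X.
Proof.
intros HX HX'. unfold yc.
apply Rlt_div_l; [lra|].
replace ((4 - 6 * X) / (27 * X + 6) * (27 * X' + 6)) with
  ((4 - 6 * X) * (27 * X' + 6) / (27 * X + 6)) by (field; lra).
apply Rlt_div_r; [lra|]. nra.
Qed.

Lemma yc_cusp1 : yc cusp1 = cusp3.
Proof.
pose proof cusp_bounds as [Hc1 Hc3].
assert (Hs : sqrt 5 * sqrt 5 = 5) by (apply sqrt_sqrt; lra).
unfold yc. apply Rmult_eq_reg_r with (27 * cusp1 + 6); [|lra].
replace ((4 - 6 * cusp1) / (27 * cusp1 + 6) * (27 * cusp1 + 6))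
  with (4 - 6 * cusp1) by (field; lra).
unfold cusp1, cusp3 in *. nra.
Qed.

Lemma yc_cusp3 : yc cusp3 = cusp1.
Proof.
pose proof cusp_bounds as [Hc1 Hc3].
rewrite <- yc_cusp1. apply yc_involutive. lra.
Qed.

Lemma yc_cusp2 : yc (2/9) = 2/9.
Proof. unfold yc. field. Qed.

Lemma is_derive_kap (X : R) : 0 < X < 2/3 -> is_derive kap X (dkap X).
Proof.
intros HX. pose proof (yc_bounds X HX) as Hy.
unfold kap, dkap, yc in *. auto_derive.
- repeat split; lra.
- field. repeat split; lra.
Qed.

Lemma dA_pos (X : R) : 0 < dA X.
Proof. apply exp_pos. Qed.

Lemma dB_pos (X : R) : 0 < dB X.
Proof. apply exp_pos. Qed.

Lemma is_derive_dA (X : R) : 0 < X < 2/3 -> is_derive dA X (dA X * dkap X).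
Proof.
intros HX. unfold dA.
replace (exp (kap X) * dkap X) with (scal (dkap X) (exp (kap X)))
  by (unfold scal; simpl; unfold mult; simpl; ring).
apply (is_derive_comp exp kap); [apply is_derive_exp | apply is_derive_kap, HX].
Qed.

Lemma is_derive_yc (X : R) :
  0 < X < 2/3 -> is_derive yc X (- 144 / (27 * X + 6)^2).
Proof.
intros HX. unfold yc. auto_derive; [lra|]. field. lra.
Qed.

(** The chain rule produces [dkap (yc X)] times the derivative of [yc], and this equals
    [sig X * dkap X]: both coordinates of the curve are critical at the same three cusps. *)
Lemma is_derive_dB (X : R) :
  0 < X < 2/3 -> is_derive dB X (dB X * (sig X * dkap X)).
Proof.
intros HX. pose proof (yc_bounds X HX) as Hy.
unfold dB.
replace (dA (yc X) * (sig X * dkap X)) with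
  (scal (- 144 / (27 * X + 6)^2) (dA (yc X) * dkap (yc X))).
- apply (is_derive_comp dA yc); [apply is_derive_dA, Hy | apply is_derive_yc, HX].
- unfold scal; simpl; unfold mult; simpl.
  unfold sig, dkap. unfold yc in *.
  replace (dA ((4 - 6 * X) / (27 * X + 6))) with (dB X) by reflexivity.
  field. repeat split; lra.
Qed.

Lemma dkap_sign (X : R) :
  0 < X < 2/3 ->
  (X < cusp1 -> dkap X < 0) /\ (cusp1 < X < 2/9 -> 0 < dkap X) /\
  (2/9 < X < cusp3 -> dkap X < 0) /\ (cusp3 < X -> 0 < dkap X).
Proof.
intros HX. pose proof cusp_bounds as [Hc1 Hc3].
assert (Hd : 0 < 35 * X * (1 - X) * (9 * X + 2) * (2 - 3 * X)).
{ repeat apply Rmult_lt_0_compat; lra. }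
unfold dkap. rewrite cusp_quadratic.
assert (Hn : forall N, N < 0 ->
  N / (35 * X * (1 - X) * (9 * X + 2) * (2 - 3 * X)) < 0).
{ intros N HN. apply Rlt_div_l; lra. }
repeat split; intros Hx.
- apply Hn.
  assert (0 < (2 - 9 * X) * (99 * (cusp1 - X) * (cusp3 - X)))
    by (repeat apply Rmult_lt_0_compat; lra). lra.
- apply Rdiv_lt_0_compat; [|exact Hd].
  assert (0 < (2 - 9 * X) * (99 * (X - cusp1) * (cusp3 - X)))
    by (repeat apply Rmult_lt_0_compat; lra). lra.
- apply Hn.
  assert (0 < (9 * X - 2) * (99 * (X - cusp1) * (cusp3 - X)))
    by (repeat apply Rmult_lt_0_compat; lra). lra.
- apply Rdiv_lt_0_compat; [|exact Hd].
  repeat apply Rmult_lt_0_compat; lra.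
Qed.

Lemma kap_decreasing_arc1 (u v : R) : 0 < u -> u < v -> v <= cusp1 -> kap v < kap u.
Proof.
intros. pose proof cusp_bounds as [Hc1 Hc3].
apply (decreasing_of_derive kap dkap); [lra | |]; intros x Hx.
- apply is_derive_kap; lra.
- destruct (dkap_sign x) as (S1 & S2 & S3 & S4); [lra|]. apply S1; lra.
Qed.

Lemma kap_increasing_arc2 (u v : R) : cusp1 <= u -> u < v -> v <= 2/9 -> kap u < kap v.
Proof.
intros. pose proof cusp_bounds as [Hc1 Hc3].
apply (increasing_of_derive kap dkap); [lra | |]; intros x Hx.
- apply is_derive_kap; lra.
- destruct (dkap_sign x) as (S1 & S2 & S3 & S4); [lra|]. apply S2; lra.
Qed.

Lemma kap_decreasing_arc3 (u v : R) : 2/9 <= u -> u < v -> v <= cusp3 -> kap v < kap u.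
Proof.
intros. pose proof cusp_bounds as [Hc1 Hc3].
apply (decreasing_of_derive kap dkap); [lra | |]; intros x Hx.
- apply is_derive_kap; lra.
- destruct (dkap_sign x) as (S1 & S2 & S3 & S4); [lra|]. apply S3; lra.
Qed.

Lemma kap_increasing_arc4 (u v : R) : cusp3 <= u -> u < v -> v < 2/3 -> kap u < kap v.
Proof.
intros. pose proof cusp_bounds as [Hc1 Hc3].
apply (increasing_of_derive kap dkap); [lra | |]; intros x Hx.
- apply is_derive_kap; lra.
- destruct (dkap_sign x) as (S1 & S2 & S3 & S4); [lra|]. apply S4; lra.
Qed.

(** [slope] times its logarithmic derivative [sig' / sig + (sig - 1) * dkap], put over the
    denominator [(1 - X) * (33 * X + 2)]. *)
Definition dslope (X : R) : R :=
  slope X * (- (35 + 5 * (9 * X - 2)^2 * (99 * X^2 - 48 * X + 4) /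
                     (35 * X * (9 * X + 2) * (2 - 3 * X))) /
             ((1 - X) * (33 * X + 2))).

Lemma slope_pos (X : R) : 0 < X < 2/3 -> 0 < slope X.
Proof.
intros HX. unfold slope, sig.
pose proof (dA_pos X). pose proof (dB_pos X).
repeat first [apply Rdiv_lt_0_compat | apply Rmult_lt_0_compat]; lra.
Qed.

Lemma is_derive_slope (X : R) : 0 < X < 2/3 -> is_derive slope X (dslope X).
Proof.
intros HX. pose proof (dA_pos X) as HA.
assert (Hs : is_derive sig X (- 420 / (33 * X + 2)^2)).
{ unfold sig. auto_derive; [lra|]. field. lra. }
assert (HN := is_derive_mult _ _ _ _ _ Hs (is_derive_dB X HX) Rmult_comm).
assert (HD := is_derive_div _ _ _ _ _ HN (is_derive_dA X HX) (Rgt_not_eq _ _ HA)).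
eapply eq_rect; [exact HD|].
unfold dslope, slope, plus, mult; simpl. unfold sig, dkap.
field. repeat split; lra.
Qed.

(** Only the quadratic with roots [cusp1] and [cusp3] can spoil the sign. It is positive up to
    [1/12] and from [39/100] on; in between, crude bounds show that the term 35 dominates. *)
Lemma dslope_neg (X : R) : 0 < X < 2/3 -> dslope X < 0.
Proof.
intros HX. pose proof (slope_pos X HX) as Hs.
unfold dslope.
set (P := 35 * X * (9 * X + 2) * (2 - 3 * X)).
assert (HP : 0 < P) by (unfold P; repeat apply Rmult_lt_0_compat; lra).
assert (HQ : 0 < (1 - X) * (33 * X + 2)) by (apply Rmult_lt_0_compat; lra).
assert (HN : 0 < 35 + 5 * (9 * X - 2)^2 * (99 * X^2 - 48 * X + 4) / P).
{ replace (35 + 5 * (9 * X - 2)^2 * (99 * X^2 - 48 * X + 4) / P) with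
    ((35 * P + 5 * (9 * X - 2)^2 * (99 * X^2 - 48 * X + 4)) / P) by (field; lra).
  apply Rdiv_lt_0_compat; [|exact HP]. unfold P.
  destruct (Rle_lt_dec X (1/12)) as [H|H].
  - assert (0 < 99 * X^2 - 48 * X + 4) by nra.
    assert (0 <= 5 * (9 * X - 2)^2 * (99 * X^2 - 48 * X + 4)).
    { apply Rmult_le_pos; [|lra]. pose proof (pow2_ge_0 (9 * X - 2)). lra. }
    fold P. lra.
  - destruct (Rle_lt_dec (39/100) X) as [H'|H'].
    + assert (0 < 99 * X^2 - 48 * X + 4) by nra.
      assert (0 <= 5 * (9 * X - 2)^2 * (99 * X^2 - 48 * X + 4)).
      { apply Rmult_le_pos; [|lra]. pose proof (pow2_ge_0 (9 * X - 2)). lra. }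
      fold P. lra.
    + assert (H1 : (9 * X - 2)^2 <= 5/2) by nra.
      (* Completing the square: the quadratic has its minimum [-20/11] at [8/33]. *)
      assert (H2 : - (99 * X^2 - 48 * X + 4) <= 2).
      { pose proof (pow2_ge_0 (X - 8/33)). lra. }
      assert (H3 : (9 * X - 2)^2 * (- (99 * X^2 - 48 * X + 4)) <= 5/2 * 2).
      { apply Rle_trans with ((9 * X - 2)^2 * 2); [|lra].
        apply Rmult_le_compat_l; [apply pow2_ge_0 | exact H2]. }
      assert (H4 : 5/2 <= (9 * X + 2) * (2 - 3 * X)) by nra.
      assert (H5 : 1/12 * (5/2) <= X * ((9 * X + 2) * (2 - 3 * X))).
      { apply Rmult_le_compat; lra. }
      replace (35 * X * (9 * X + 2) * (2 - 3 * X)) with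
        (35 * (X * ((9 * X + 2) * (2 - 3 * X)))) by ring.
      lra. }
replace (- (35 + 5 * (9 * X - 2)^2 * (99 * X^2 - 48 * X + 4) / P) /
         ((1 - X) * (33 * X + 2))) with
  (- ((35 + 5 * (9 * X - 2)^2 * (99 * X^2 - 48 * X + 4) / P) /
      ((1 - X) * (33 * X + 2)))) by (field; lra).
assert (0 < slope X * ((35 + 5 * (9 * X - 2)^2 * (99 * X^2 - 48 * X + 4) / P) /
      ((1 - X) * (33 * X + 2)))).
{ apply Rmult_lt_0_compat; [exact Hs|]. apply Rdiv_lt_0_compat; assumption. }
lra.
Qed.

Lemma slope_decreasing (u v : R) : 0 < u -> u < v -> v < 2/3 -> slope v < slope u.
Proof.
intros. apply (decreasing_of_derive slope dslope); [lra | |]; intros x Hx.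
- apply is_derive_slope; lra.
- apply dslope_neg; lra.
Qed.

Lemma slope_cusp2 : slope (2/9) = 1.
Proof.
unfold slope, sig, dB. rewrite yc_cusp2.
pose proof (dA_pos (2/9)). field. lra.
Qed.

Lemma dB_derive_slope (X : R) :
  0 < X < 2/3 -> is_derive dB X (slope X * (dA X * dkap X)).
Proof.
intros HX. pose proof (dA_pos X) as HA.
replace (slope X * (dA X * dkap X)) with (dB X * (sig X * dkap X)).
- apply is_derive_dB, HX.
- unfold slope. field. lra.
Qed.

Lemma dA_lt (u v : R) : kap u < kap v -> dA u < dA v.
Proof. apply exp_increasing. Qed.

(** * Height of the discriminant curve above the diagonal *)

(** The height [dB - dA] has derivative [(slope - 1) * dA * dkap]; before [2/9] the slope exceeds 1,
    and [dkap] is negative on arc 1. On arc 3 the first factor changes sign. *)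
Lemma gap_decreasing_arc1 (u v : R) :
  0 < u -> u < v -> v <= cusp1 -> dB v - dA v < dB u - dA u.
Proof.
intros. pose proof cusp_bounds.
apply (decreasing_of_derive (fun x => dB x - dA x)
  (fun x => slope x * (dA x * dkap x) - dA x * dkap x)); [lra | |]; intros x Hx.
- apply (is_derive_minus dB dA); [apply dB_derive_slope | apply is_derive_dA]; lra.
- assert (1 < slope x) by (rewrite <- slope_cusp2; apply slope_decreasing; lra).
  assert (dkap x < 0)
    by (destruct (dkap_sign x) as (S1 & S2 & S3 & S4); [lra|]; apply S1; lra).
  pose proof (dA_pos x).
  assert (0 < (slope x - 1) * (dA x * - dkap x))
    by (repeat apply Rmult_lt_0_compat; lra).
  lra.
Qed.

Lemma gap_increasing_arc3 (u v : R) :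
  2/9 <= u -> u < v -> v <= cusp3 -> dB u - dA u < dB v - dA v.
Proof.
intros. pose proof cusp_bounds.
apply (increasing_of_derive (fun x => dB x - dA x)
  (fun x => slope x * (dA x * dkap x) - dA x * dkap x)); [lra | |]; intros x Hx.
- apply (is_derive_minus dB dA); [apply dB_derive_slope | apply is_derive_dA]; lra.
- assert (slope x < 1) by (rewrite <- slope_cusp2; apply slope_decreasing; lra).
  assert (dkap x < 0)
    by (destruct (dkap_sign x) as (S1 & S2 & S3 & S4); [lra|]; apply S3; lra).
  pose proof (dA_pos x).
  assert (0 < (1 - slope x) * (dA x * - dkap x))
    by (repeat apply Rmult_lt_0_compat; lra).
  lra.
Qed.

Lemma gap_cusp2 : dB (2/9) - dA (2/9) = 0.
Proof. unfold dB. rewrite yc_cusp2. ring. Qed.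

(** * Rational bounds for points of the discriminant curve *)

Lemma ln_dA_weights (X r : R) :
  0 < X < 2/3 -> 0 < r ->
  ln (r^35 * (X^2 * (yc X)^12)) = 35 * ln r + 2 * ln X + 12 * ln (yc X).
Proof.
intros HX Hr. pose proof (yc_bounds X HX) as Hy.
assert (HX2 : 0 < X) by lra. assert (Hy2 : 0 < yc X) by lra.
assert (0 < r^35) by (apply pow_lt; lra).
assert (0 < X^2) by (apply pow_lt; lra).
assert (0 < (yc X)^12) by (apply pow_lt; lra).
rewrite ln_mult; [|assumption|apply Rmult_lt_0_compat; assumption].
rewrite ln_mult by assumption.
rewrite !ln_pow by assumption.
replace (INR 35) with 35 by (simpl; ring).
replace (INR 12) with 12 by (simpl; ring).
simpl (INR 2). ring.
Qed.

Lemma ln_pow35 (X : R) : X < 1 -> ln ((1 - X)^35) = 35 * ln (1 - X).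
Proof.
intros HX. rewrite ln_pow; [|lra].
replace (INR 35) with 35 by (simpl; ring). reflexivity.
Qed.

Lemma dA_weights_pos (X r : R) :
  0 < X < 2/3 -> 0 < r -> 0 < r^35 * (X^2 * (yc X)^12).
Proof.
intros HX Hr. pose proof (yc_bounds X HX) as Hy.
apply Rmult_lt_0_compat; [|apply Rmult_lt_0_compat]; apply pow_lt; lra.
Qed.

(** Taking 35th powers clears the exponents [2/35] and [12/35], so that for rational [X] and [r] the
    comparison becomes one of rational numbers, decided by computation. *)
Lemma dA_gt_of_pow (X r : R) :
  0 < X < 2/3 -> 0 < r -> r^35 * (X^2 * (yc X)^12) < (1 - X)^35 -> r < dA X.
Proof.
intros HX Hr H. apply ln_increasing in H; [|apply dA_weights_pos; assumption].
rewrite ln_dA_weights, ln_pow35 in H by lra.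
rewrite <- (exp_ln r Hr). apply exp_increasing. unfold kap. lra.
Qed.

Lemma dA_lt_of_pow (X r : R) :
  0 < X < 2/3 -> 0 < r -> (1 - X)^35 < r^35 * (X^2 * (yc X)^12) -> dA X < r.
Proof.
intros HX Hr H. apply ln_increasing in H; [|apply pow_lt; lra].
rewrite ln_dA_weights, ln_pow35 in H by lra.
rewrite <- (exp_ln r Hr). apply exp_increasing. unfold kap. lra.
Qed.

(** The sample parameters: [1/13] is the centre on arc 1, [1/11] and [1/3] bound the relevant parts
    of arcs 1 and 3, and by [1/15] arc 1 extends beyond the abscissa [44/31]. *)
Lemma yc_values : yc (1/11) = 38/93 /\ yc (1/3) = 2/15 /\ yc (1/13) = 46/105 /\
  yc (1/15) = 6/13.
Proof. unfold yc. repeat split; field. Qed.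

Lemma dA_1_11 : 141704/100000 < dA (1/11) < 141705/100000.
Proof.
destruct yc_values as (E & _).
split; [apply dA_gt_of_pow | apply dA_lt_of_pow]; rewrite ?E; lra.
Qed.

Lemma dB_1_11 : 141625/100000 < dB (1/11) < 141626/100000.
Proof.
destruct yc_values as (E & _).
assert (E' : yc (38/93) = 1/11) by (rewrite <- E; apply yc_involutive; lra).
unfold dB. rewrite E.
split; [apply dA_gt_of_pow | apply dA_lt_of_pow]; rewrite ?E'; lra.
Qed.

Lemma dA_1_3 : 141642/100000 < dA (1/3) < 141643/100000.
Proof.
destruct yc_values as (_ & E & _).
split; [apply dA_gt_of_pow | apply dA_lt_of_pow]; rewrite ?E; lra.
Qed.

Lemma dB_1_3 : 141722/100000 < dB (1/3) < 141723/100000.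
Proof.
destruct yc_values as (_ & E & _).
assert (E' : yc (2/15) = 1/3) by (rewrite <- E; apply yc_involutive; lra).
unfold dB. rewrite E.
split; [apply dA_gt_of_pow | apply dA_lt_of_pow]; rewrite ?E'; lra.
Qed.

Lemma dA_1_13 : 141834/100000 < dA (1/13) < 141835/100000.
Proof.
destruct yc_values as (_ & _ & E & _).
split; [apply dA_gt_of_pow | apply dA_lt_of_pow]; rewrite ?E; lra.
Qed.

Lemma dB_1_13 : 141927/100000 < dB (1/13) < 141928/100000.
Proof.
destruct yc_values as (_ & _ & E & _).
assert (E' : yc (46/105) = 1/13) by (rewrite <- E; apply yc_involutive; lra).
unfold dB. rewrite E.
split; [apply dA_gt_of_pow | apply dA_lt_of_pow]; rewrite ?E'; lra.
Qed.

Lemma dA_1_15 : 44/31 < dA (1/15).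
Proof.
destruct yc_values as (_ & _ & _ & E).
apply dA_gt_of_pow; rewrite ?E; lra.
Qed.

Lemma dA_cusp2 : 44/31 < dA (2/9).
Proof. apply dA_gt_of_pow; rewrite ?yc_cusp2; lra. Qed.

(** * Star-shapedness of the region below the upper arcs *)

(** The height above (c, c) of the tangent line to the curve at parameter [X]. *)
Definition tangent_gap (c X : R) : R := dB X - c + slope X * (c - dA X).

Lemma is_derive_tangent_gap (c X : R) :
  0 < X < 2/3 -> is_derive (tangent_gap c) X (dslope X * (c - dA X)).
Proof.
intros HX. unfold tangent_gap.
assert (H1 := is_derive_minus _ _ _ _ _ (dB_derive_slope X HX) (is_derive_const c X)).
assert (H2 := is_derive_minus _ _ _ _ _ (is_derive_const c X) (is_derive_dA X HX)).
assert (H3 := is_derive_mult _ _ _ _ _ (is_derive_slope X HX) H2 Rmult_comm).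
assert (H4 := is_derive_plus _ _ _ _ _ H1 H3).
eapply eq_rect; [exact H4|].
unfold plus, minus, plus, opp, mult, zero; simpl. unfold zero; simpl. ring.
Qed.

Lemma is_derive_chord_slope (c X : R) :
  0 < X < 2/3 -> dA X <> c ->
  is_derive (fun x => (dB x - c) / (dA x - c)) X
    (dA X * - dkap X * tangent_gap c X / (dA X - c)^2).
Proof.
intros HX Hc.
assert (H1 := is_derive_minus _ _ _ _ _ (dB_derive_slope X HX) (is_derive_const c X)).
assert (H2 := is_derive_minus _ _ _ _ _ (is_derive_dA X HX) (is_derive_const c X)).
assert (Hn : minus (dA X) c <> 0) by (unfold minus, plus, opp; simpl; lra).
assert (H3 := is_derive_div _ _ _ _ _ H1 H2 Hn).
eapply eq_rect; [exact H3|].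
unfold tangent_gap, minus, plus, opp, zero; simpl. unfold zero; simpl.
field. lra.
Qed.

Lemma chord_slope_increasing (c u v : R) :
  0 < u -> u < v -> v < 2/3 ->
  (forall x, u <= x <= v -> dkap x < 0 /\ 0 < tangent_gap c x /\ dA x <> c) ->
  (dB u - c) / (dA u - c) < (dB v - c) / (dA v - c).
Proof.
intros Hu Huv Hv H.
apply (increasing_of_derive (fun x => (dB x - c) / (dA x - c))
  (fun X => dA X * - dkap X * tangent_gap c X / (dA X - c)^2)); [lra | |]; intros x Hx.
- apply is_derive_chord_slope; [lra | apply H; lra].
- destruct (H x) as (Hk & HT & Hn); [lra|].
  pose proof (dA_pos x).
  apply Rdiv_lt_0_compat; [repeat apply Rmult_lt_0_compat; lra|].
  apply pow2_gt_0. lra.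
Qed.

Lemma dA_decreasing (u v : R) :
  0 < u -> u < v -> v < 2/3 -> (forall x, u < x < v -> dkap x < 0) -> dA v < dA u.
Proof.
intros Hu Huv Hv H.
apply (decreasing_of_derive dA (fun x => dA x * dkap x)); [lra | |]; intros x Hx.
- apply is_derive_dA; lra.
- specialize (H x Hx). pose proof (dA_pos x).
  assert (0 < dA x * - dkap x) by (apply Rmult_lt_0_compat; lra). lra.
Qed.

(** Since the chord slope from (c, c) is monotone in [X], the arc between [Xc] and [Xa] lies above
    the chord from (c, c) to its point over [a], hence above the segment to (a, b). [Rmin] and
    [Rmax] allow the target on either side of the centre. *)
Lemma below_arc_star (c a b t Xc Xa : R) :
  0 < Rmin Xc Xa -> Rmax Xc Xa < 2/3 ->
  (forall x, Rmin Xc Xa <= x <= Rmax Xc Xa -> dkap x < 0 /\ 0 < tangent_gap c x) ->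
  dA Xc = c -> c < dB Xc -> dA Xa = a -> b < dB Xa -> 0 <= t <= 1 ->
  exists X, Rmin Xc Xa <= X <= Rmax Xc Xa /\
    dA X = (1 - t) * c + t * a /\ (1 - t) * c + t * b < dB X.
Proof.
intros Hmin Hmax H HA HB HAa HBb Ht.
pose proof (Rmin_l Xc Xa). pose proof (Rmin_r Xc Xa).
pose proof (Rmax_l Xc Xa). pose proof (Rmax_r Xc Xa).
destruct (Req_dec t 0) as [->|Ht0].
{ exists Xc. split; [lra|]. split; lra. }
destruct (Req_dec t 1) as [->|Ht1].
{ exists Xa. split; [lra|]. split; lra. }
destruct (Rtotal_order Xa Xc) as [Hlt|[Heq|Hgt]].
- rewrite Rmin_right, Rmax_left in * by lra.
  assert (Hca : c < a).
  { rewrite <- HA, <- HAa. apply dA_decreasing; try lra. intros; apply H; lra. }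
  destruct (ivt_decr dA (fun x => dA x * dkap x) Xa Xc ((1 - t) * c + t * a))
    as [X [HX1 HX2]]; try lra.
  { intros; apply is_derive_dA; lra. }
  { rewrite HA, HAa. split; nra. }
  exists X. split; [lra|]. split; [exact HX2|].
  assert (Hr : (dB Xa - c) / (dA Xa - c) < (dB X - c) / (dA X - c)).
  { apply chord_slope_increasing; try lra.
    intros x Hx. destruct (H x) as [Hk HT]; [lra|]. repeat split; try lra.
    apply Rgt_not_eq. rewrite <- HA. apply dA_decreasing; try lra.
    intros; apply H; lra. }
  rewrite HX2, HAa in Hr.
  replace ((1 - t) * c + t * a - c) with (t * (a - c)) in Hr by ring.
  (* Clearing the positive denominators gives [t * (dB Xa - c) < dB X - c]. *)
  assert (Hm := Rmult_lt_compat_l (t * (a - c)) _ _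
    ltac:(apply Rmult_lt_0_compat; lra) Hr).
  replace (t * (a - c) * ((dB Xa - c) / (a - c))) with (t * (dB Xa - c)) in Hm
    by (field; lra).
  replace (t * (a - c) * ((dB X - c) / (t * (a - c)))) with (dB X - c) in Hm
    by (field; lra).
  assert (t * b < t * dB Xa) by (apply Rmult_lt_compat_l; lra). lra.
- subst Xa. exists Xc. split; [lra|]. split; nra.
(* The mirror case [a < c]: the chord slopes compare the other way, and clearing the now negative
   denominators restores the same inequality. *)
- rewrite Rmin_left, Rmax_right in * by lra.
  assert (Hca : a < c).
  { rewrite <- HA, <- HAa. apply dA_decreasing; try lra. intros; apply H; lra. }
  destruct (ivt_decr dA (fun x => dA x * dkap x) Xc Xa ((1 - t) * c + t * a))
    as [X [HX1 HX2]]; try lra.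
  { intros; apply is_derive_dA; lra. }
  { rewrite HA, HAa. split; nra. }
  exists X. split; [lra|]. split; [exact HX2|].
  assert (Hr : (dB X - c) / (dA X - c) < (dB Xa - c) / (dA Xa - c)).
  { apply chord_slope_increasing; try lra.
    intros x Hx. destruct (H x) as [Hk HT]; [lra|]. repeat split; try lra.
    apply Rlt_not_eq. rewrite <- HA. apply dA_decreasing; try lra.
    intros; apply H; lra. }
  rewrite HX2, HAa in Hr.
  replace ((1 - t) * c + t * a - c) with (t * (a - c)) in Hr by ring.
  assert (Hm := Rmult_lt_compat_l (t * (c - a)) _ _
    ltac:(apply Rmult_lt_0_compat; lra) Hr).
  replace (t * (c - a) * ((dB Xa - c) / (a - c))) with (- (t * (dB Xa - c))) in Hm
    by (field; lra).
  replace (t * (c - a) * ((dB X - c) / (t * (a - c)))) with (- (dB X - c)) in Hm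
    by (field; lra).
  assert (t * b < t * dB Xa) by (apply Rmult_lt_compat_l; lra). lra.
Qed.

(** Phrased by parameters: the witnesses pick the points of arcs 1 and 3 over [a], so [a] must lie
    in the range of both arcs. *)
Definition below_upper_arcs (a b : R) : Prop :=
  (exists X, 0 < X < cusp1 /\ dA X = a /\ b < dB X) /\
  (exists X, 2/9 < X < cusp3 /\ dA X = a /\ b < dB X).

(** Defined as a value of [dA] so that its parameter on arc 1 is exactly [1/13]. *)
Definition star_center : R := dA (1/13).

(** Here the arc is to the left of the centre, so the gap decreases in [X] and its value at [1/11]
    decides. *)
Lemma tangent_gap_arc1 (X : R) :
  1/13 <= X <= 1/11 -> 0 < tangent_gap star_center X.
Proof.
intros HX. pose proof cusp_bounds as [Hc1 Hc3].
assert (H0 : 0 < tangent_gap star_center (1/11)).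
{ unfold tangent_gap, star_center.
  pose proof dA_1_11. pose proof dB_1_11. pose proof dA_1_13.
  (* [sig (1/11)] is [24/11], and [dB / dA] is close to 1. *)
  assert (Hs : 2 < slope (1/11)).
  { unfold slope, sig.
    apply Rlt_div_r; [apply dA_pos|]. lra. }
  assert (2 * (dA (1/13) - dA (1/11)) < slope (1/11) * (dA (1/13) - dA (1/11)))
    by (apply Rmult_lt_compat_r; lra).
  lra. }
destruct (Req_dec X (1/11)) as [->|Hne]; [exact H0|].
apply Rlt_trans with (1 := H0).
apply (decreasing_of_derive (tangent_gap star_center)
  (fun x => dslope x * (star_center - dA x))); [lra | |]; intros x Hx.
- apply is_derive_tangent_gap; lra.
- assert (dA x < star_center)
    by (apply dA_lt, kap_decreasing_arc1; lra).
  pose proof (dslope_neg x ltac:(lra)).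
  assert (0 < - dslope x * (star_center - dA x)) by (apply Rmult_lt_0_compat; lra).
  lra.
Qed.

(** To the right of the centre the gap increases from its value 0 at the cusp, whose tangent is the
    diagonal; to the left it decreases towards the positive value at [1/3]. *)
Lemma tangent_gap_arc3 (X : R) :
  2/9 < X <= 1/3 -> 0 < tangent_gap star_center X.
Proof.
intros HX. pose proof cusp_bounds as [Hc1 Hc3].
assert (H0 : 0 < tangent_gap star_center (1/3)).
{ unfold tangent_gap, star_center.
  pose proof dA_1_3. pose proof dB_1_3. pose proof dA_1_13.
  assert (Hs : 6157/10000 < slope (1/3)).
  { unfold slope, sig.
    apply (Rlt_div_r _ _ (dA (1/3))); [apply dA_pos|]. lra. }
  assert (6157/10000 * (dA (1/13) - dA (1/3)) < slope (1/3) * (dA (1/13) - dA (1/3)))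
    by (apply Rmult_lt_compat_r; lra).
  lra. }
destruct (Rle_lt_dec star_center (dA X)) as [Hle|Hlt].
- replace 0 with (tangent_gap star_center (2/9)).
  2:{ unfold tangent_gap. rewrite slope_cusp2. pose proof gap_cusp2. lra. }
  apply (increasing_of_derive (tangent_gap star_center)
    (fun x => dslope x * (star_center - dA x))); [lra | |]; intros x Hx.
  + apply is_derive_tangent_gap; lra.
  + assert (dA X < dA x) by (apply dA_lt, kap_decreasing_arc3; lra).
    pose proof (dslope_neg x ltac:(lra)).
    assert (0 < - dslope x * (dA x - star_center)) by (apply Rmult_lt_0_compat; lra).
    lra.
- destruct (Req_dec X (1/3)) as [->|Hne]; [exact H0|].
  apply Rlt_trans with (1 := H0).
  apply (decreasing_of_derive (tangent_gap star_center)
    (fun x => dslope x * (star_center - dA x))); [lra | |]; intros x Hx.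
  + apply is_derive_tangent_gap; lra.
  + assert (dA x < dA X) by (apply dA_lt, kap_decreasing_arc3; lra).
    pose proof (dslope_neg x ltac:(lra)).
    assert (0 < - dslope x * (star_center - dA x)) by (apply Rmult_lt_0_compat; lra).
    lra.
Qed.

Lemma arc3_reaches (a : R) :
  dA (1/3) < a -> a < dA (2/9) -> exists X, 2/9 < X < 1/3 /\ dA X = a.
Proof.
intros. apply (ivt_decr dA (fun x => dA x * dkap x)); [lra | | lra].
intros; apply is_derive_dA; lra.
Qed.

Lemma above_diagonal_arc3 (X : R) : 2/9 < X < cusp3 -> dA X < dB X.
Proof.
intros HX. pose proof (gap_increasing_arc3 (2/9) X). pose proof gap_cusp2. lra.
Qed.

Lemma above_diagonal_arc1 (X : R) : 0 < X <= 1/13 -> dA X < dB X.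
Proof.
intros HX. pose proof dA_1_13. pose proof dB_1_13. pose proof cusp_bounds.
destruct (Req_dec X (1/13)) as [->|]; [lra|].
pose proof (gap_decreasing_arc1 X (1/13)). lra.
Qed.

Lemma diagonal_below_upper_arcs (a : R) :
  star_center <= a <= 44/31 -> below_upper_arcs a a.
Proof.
intros Ha. pose proof cusp_bounds as [Hc1 Hc3]. unfold star_center in Ha.
pose proof dA_1_13. pose proof dA_1_3. pose proof dA_1_15. pose proof dA_cusp2.
split.
- destruct (Req_dec a (dA (1/13))) as [->|Hne].
  + exists (1/13). split; [lra|]. split; [reflexivity|]. apply above_diagonal_arc1; lra.
  + destruct (ivt_decr dA (fun x => dA x * dkap x) (1/15) (1/13) a)
      as [X [HX1 HX2]]; try lra.
    { intros; apply is_derive_dA; lra. }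
    exists X. split; [lra|]. split; [exact HX2|].
    rewrite <- HX2. apply above_diagonal_arc1; lra.
- destruct (arc3_reaches a) as [X [HX1 HX2]]; try lra.
  exists X. split; [lra|]. split; [exact HX2|].
  rewrite <- HX2. apply above_diagonal_arc3; lra.
Qed.

(** From [1/11] on, arc 1 lies below the diagonal: it does so at [1/11], and its height over the
    diagonal decreases. *)
Lemma abscissa_bound_one_sided (a b : R) :
  below_upper_arcs a b -> a <= dA (1/11) -> b < a.
Proof.
intros [(X & HX & HA & HB) _] Ha. pose proof cusp_bounds.
pose proof dA_1_11. pose proof dB_1_11.
destruct (Rlt_le_dec X (1/11)) as [Hl|Hl].
- pose proof (dA_lt _ _ (kap_decreasing_arc1 X (1/11) ltac:(lra) Hl ltac:(lra))). lra.
- destruct (Req_dec X (1/11)) as [->|]; [lra|].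
  pose proof (gap_decreasing_arc1 (1/11) X). lra.
Qed.

(** Otherwise [b < a], so [b] is also at most [dA (1/11)], and exchanging the two coordinates gives
    [a < b]. This confines the arcs to the parts where the tangent gap is known to be positive. *)
Lemma abscissa_lower_bound (a b : R) :
  below_upper_arcs a b -> below_upper_arcs b a -> dA (1/11) < a.
Proof.
intros H1 H2. destruct (Rlt_le_dec (dA (1/11)) a) as [|Hl]; [assumption|].
pose proof (abscissa_bound_one_sided a b H1 Hl).
pose proof (abscissa_bound_one_sided b a H2). lra.
Qed.

(** The tangent argument handles arc 3 throughout and arc 1 to the left of the centre; to the right
    of the centre arc 1 is compared with arc 3. *)
Lemma below_upper_arcs_star (a b t : R) :
  dA (1/11) < a -> below_upper_arcs a b -> 0 <= t <= 1 ->
  below_upper_arcs ((1 - t) * star_center + t * a) ((1 - t) * star_center + t * b).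
Proof.
intros Ha [(X1 & HX1 & HA1 & HB1) (X3 & HX3 & HA3 & HB3)] Ht.
pose proof cusp_bounds as [Hc1 Hc3].
pose proof dA_1_13. pose proof dB_1_13. pose proof dA_1_3. pose proof dB_1_3.
pose proof dA_cusp2. pose proof dA_1_11.
set (c := star_center) in *.
assert (Hcv : c = dA (1/13)) by reflexivity.
(* Because [dA (1/3) < dA (1/11) < a] and [dA] decreases along arc 3. *)
assert (HX3' : X3 < 1/3).
{ destruct (Rlt_le_dec X3 (1/3)) as [|Hl]; [assumption|].
  destruct (Req_dec X3 (1/3)) as [->|]; [lra|].
  pose proof (dA_lt _ _ (kap_decreasing_arc3 (1/3) X3 ltac:(lra) ltac:(lra) ltac:(lra))). lra. }
destruct (arc3_reaches c) as [Xc [HXc HAc]]; try lra.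
assert (Hm : 2/9 < Rmin Xc X3) by (apply Rmin_glb_lt; lra).
assert (HM : Rmax Xc X3 < 1/3) by (apply Rmax_lub_lt; lra).
destruct (below_arc_star c a b t Xc X3) as (Y3 & HY3 & HAY3 & HBY3); try lra.
{ intros x Hx. split.
  - destruct (dkap_sign x) as (S1 & S2 & S3 & S4); [lra|]. apply S3; lra.
  - apply tangent_gap_arc3; lra. }
{ rewrite <- HAc. apply above_diagonal_arc3; lra. }
split; [|exists Y3; split; [lra|split; assumption]].
destruct (Rlt_le_dec X1 (1/13)) as [Hl|Hl].
- assert (Hac : c < a).
  { rewrite <- HA1, Hcv. apply dA_lt, kap_decreasing_arc1; lra. }
  assert (Hw : c <= (1 - t) * c + t * a <= a) by (split; nra).
  assert (HY1 : exists Y1, X1 <= Y1 <= 1/13 /\ dA Y1 = (1 - t) * c + t * a).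
  { destruct (Req_dec ((1 - t) * c + t * a) c) as [->|].
    - exists (1/13). split; [lra|reflexivity].
    - destruct (Req_dec ((1 - t) * c + t * a) a) as [->|].
      + exists X1. split; [lra|assumption].
      + destruct (ivt_decr dA (fun x => dA x * dkap x) X1 (1/13) ((1 - t) * c + t * a))
          as [Y1 [HY1 HAY1]]; try lra.
        { intros; apply is_derive_dA; lra. }
        exists Y1. split; [lra|assumption]. }
  destruct HY1 as (Y1 & HY1 & HAY1).
  exists Y1. split; [lra|]. split; [exact HAY1|].
  (* To the right of the centre arc 1 runs above arc 3. *)
  assert (HY3' : Y3 < 1/3) by lra.
  assert (dB Y3 - dA Y3 < dB (1/3) - dA (1/3)) by (apply gap_increasing_arc3; lra).
  assert (dB (1/13) - dA (1/13) <= dB Y1 - dA Y1).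
  { destruct (Req_dec Y1 (1/13)) as [->|]; [lra|].
    apply Rlt_le, gap_decreasing_arc1; lra. }
  lra.
- assert (HX1' : X1 < 1/11).
  { destruct (Rlt_le_dec X1 (1/11)) as [|Hl']; [assumption|].
    destruct (Req_dec X1 (1/11)) as [->|]; [lra|].
    pose proof (dA_lt _ _ (kap_decreasing_arc1 (1/11) X1 ltac:(lra) ltac:(lra) ltac:(lra))).
    lra. }
  assert (Hm1 : 1/13 <= Rmin (1/13) X1) by (rewrite Rmin_left; lra).
  assert (HM1 : Rmax (1/13) X1 < 1/11) by (apply Rmax_lub_lt; lra).
  destruct (below_arc_star c a b t (1/13) X1) as (Y1 & HY1 & HAY1 & HBY1); try lra.
  { intros x Hx. split.
    - destruct (dkap_sign x) as (S1 & S2 & S3 & S4); [lra|]. apply S1; lra.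
    - apply tangent_gap_arc1; lra. }
  exists Y1. split; [lra|split; assumption].
Qed.

(** * The fibre over a fixed [a], parametrised by [X = x^6 / y] *)

(** The equations [a y^2 = 1 - X], [x^6 = X y], [Y = y^6 / x] and [b x^2 = 1 - Y] are solved in this
    order; in logarithms the first three are linear. *)
Definition log_y (a X : R) : R := (ln (1 - X) - ln a) / 2.
Definition log_x (a X : R) : R := (ln X + log_y a X) / 6.
Definition fib_x (a X : R) : R := exp (log_x a X).
Definition fib_y (a X : R) : R := exp (log_y a X).
Definition fib_Y (a X : R) : R := exp (6 * log_y a X - log_x a X).
Definition fib_b (a X : R) : R := exp (- 2 * log_x a X) * (1 - fib_Y a X).

(* The Jacobian determinant at the root, in the coordinates [X] and [Y = y^6 / x]. *)
Definition jac (a X : R) : R :=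
  27 * X * fib_Y a X + 6 * X + 6 * fib_Y a X - 4.

Lemma exp_pow (u : R) (n : nat) : exp u ^ n = exp (INR n * u).
Proof.
induction n as [|n IH].
- simpl. rewrite Rmult_0_l, exp_0. reflexivity.
- rewrite S_INR. simpl. rewrite IH, <- exp_plus. f_equal. ring.
Qed.

Lemma exp_pow6 (u : R) : exp u ^ 6 = exp (6 * u).
Proof. rewrite exp_pow. f_equal. simpl. ring. Qed.

Lemma exp_pow2 (u : R) : exp u ^ 2 = exp (2 * u).
Proof. rewrite exp_pow. f_equal. Qed.

Lemma fib_x6 (a X : R) : 0 < X -> fib_x a X ^ 6 = X * fib_y a X.
Proof.
intros HX. unfold fib_x, fib_y. rewrite exp_pow6.
rewrite <- (exp_ln X HX) at 2. rewrite <- exp_plus. f_equal.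
unfold log_x. field.
Qed.

Lemma fib_y6 (a X : R) : fib_y a X ^ 6 = fib_Y a X * fib_x a X.
Proof.
unfold fib_x, fib_y, fib_Y. rewrite exp_pow6, <- exp_plus. f_equal. ring.
Qed.

Lemma fib_y2 (a X : R) : 0 < a -> X < 1 -> a * fib_y a X ^ 2 = 1 - X.
Proof.
intros Ha HX. unfold fib_y. rewrite exp_pow2.
rewrite <- (exp_ln a Ha) at 1. rewrite <- exp_plus.
transitivity (exp (ln (1 - X))); [|apply exp_ln; lra].
f_equal. unfold log_y. field.
Qed.

Lemma fib_x2 (a X : R) : fib_b a X * fib_x a X ^ 2 = 1 - fib_Y a X.
Proof.
unfold fib_b, fib_x. rewrite exp_pow2.
replace (exp (-2 * log_x a X) * (1 - fib_Y a X) * exp (2 * log_x a X)) with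
  (exp (-2 * log_x a X) * exp (2 * log_x a X) * (1 - fib_Y a X)) by ring.
rewrite <- exp_plus. replace (-2 * log_x a X + 2 * log_x a X) with 0 by ring.
rewrite exp_0. ring.
Qed.

Lemma fib_pos (a X : R) : in_pos_quadrant (fib_x a X, fib_y a X).
Proof. split; apply exp_pos. Qed.

Lemma fib_is_root (a X : R) :
  0 < a -> 0 < X < 1 -> is_root a (fib_b a X) (fib_x a X, fib_y a X).
Proof.
intros Ha HX. unfold is_root, H1, H2; simpl fst; simpl snd.
rewrite fib_x6, fib_y6 by lra. split.
- replace (a * fib_y a X ^ 3) with (a * fib_y a X ^ 2 * fib_y a X) by ring.
  rewrite fib_y2 by lra. ring.
- replace (fib_b a X * fib_x a X ^ 3) with (fib_b a X * fib_x a X ^ 2 * fib_x a X) by ring.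
  rewrite fib_x2. ring.
Qed.

(** Dividing the first equation by [y] gives [a y^2 = 1 - x^6 / y], whence [x^6 / y < 1]; logarithms
    then recover [y] and [x] from this parameter. *)
Lemma root_fib (a b x y : R) :
  0 < a -> 0 < x -> 0 < y -> is_root a b (x, y) ->
  0 < x^6 / y < 1 /\ x = fib_x a (x^6 / y) /\ y = fib_y a (x^6 / y) /\
  fib_b a (x^6 / y) = b.
Proof.
intros Ha Hx Hy [E1 E2]. unfold H1, H2 in *; simpl fst in *; simpl snd in *.
assert (HX0 : 0 < x^6 / y) by (apply Rdiv_lt_0_compat; [apply pow_lt|]; lra).
assert (Hay : a * y^2 = 1 - x^6 / y).
{ replace (x^6) with (y - a * y^3) by lra. field. lra. }
assert (Hay0 : 0 < a * y^2) by (apply Rmult_lt_0_compat; [|apply pow_lt]; lra).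
assert (HX : 0 < x^6 / y < 1) by lra.
assert (Ly : ln y = log_y a (x^6 / y)).
{ unfold log_y. rewrite <- Hay, ln_mult, ln_pow by (try apply pow_lt; lra).
  simpl (INR 2). field. }
assert (Lx : ln x = log_x a (x^6 / y)).
{ unfold log_x. rewrite <- Ly, ln_div, ln_pow by (try apply pow_lt; lra).
  replace (INR 6) with 6 by (simpl; ring). field. }
assert (Hfx : x = fib_x a (x^6 / y)) by (unfold fib_x; rewrite <- Lx, exp_ln; lra).
assert (Hfy : y = fib_y a (x^6 / y)) by (unfold fib_y; rewrite <- Ly, exp_ln; lra).
split; [exact HX|]. split; [exact Hfx|]. split; [exact Hfy|].
(* Both [fib_b a (x^6 / y)] and [b] satisfy the second equation at this point, where the coefficient
   [x^3] is positive. *)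
pose proof (fib_is_root a (x^6 / y) Ha HX) as HR.
rewrite <- Hfx, <- Hfy in HR. destruct HR as [_ HR].
unfold H2 in HR; simpl fst in HR; simpl snd in HR.
apply Rmult_eq_reg_r with (x^3); [lra|]. apply Rgt_not_eq, pow_lt; lra.
Qed.

Lemma jacobian_det_eq (a b x y : R) :
  jacobian_det a b (x, y) =
    36 * x^5 * y^5 - (3 * a * y^2 - 1) * (3 * b * x^2 - 1).
Proof.
unfold jacobian_det, H1, H2; simpl fst; simpl snd.
assert (D1 : Derive (fun u => u^6 + a * y^3 - y) x = 6 * x^5)
  by (apply is_derive_unique; auto_derive; [trivial | ring]).
assert (D2 : Derive (fun v => v^6 + b * x^3 - x) y = 6 * y^5)
  by (apply is_derive_unique; auto_derive; [trivial | ring]).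
assert (D3 : Derive (fun v => x^6 + a * v^3 - v) y = 3 * a * y^2 - 1)
  by (apply is_derive_unique; auto_derive; [trivial | ring]).
assert (D4 : Derive (fun u => y^6 + b * u^3 - u) x = 3 * b * x^2 - 1)
  by (apply is_derive_unique; auto_derive; [trivial | ring]).
rewrite D1, D2, D3, D4. ring.
Qed.

(** [x^6 y^6 = X Y x y] gives [x^5 y^5 = X Y], so the determinant is
    [36 X Y - (2 - 3 X) (2 - 3 Y)]. *)
Lemma jacobian_det_fib (a X : R) :
  0 < a -> 0 < X < 1 ->
  jacobian_det a (fib_b a X) (fib_x a X, fib_y a X) = jac a X.
Proof.
intros Ha HX. rewrite jacobian_det_eq.
pose proof (fib_pos a X) as [Px Py]; simpl in Px, Py.
assert (H : fib_x a X ^ 5 * fib_y a X ^ 5 = X * fib_Y a X).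
{ apply Rmult_eq_reg_r with (fib_x a X * fib_y a X);
    [|apply Rgt_not_eq, Rmult_lt_0_compat; assumption].
  replace (fib_x a X ^ 5 * fib_y a X ^ 5 * (fib_x a X * fib_y a X)) with
    (fib_x a X ^ 6 * fib_y a X ^ 6) by ring.
  rewrite fib_x6, fib_y6 by lra. ring. }
replace (36 * fib_x a X ^ 5 * fib_y a X ^ 5) with
  (36 * (fib_x a X ^ 5 * fib_y a X ^ 5)) by ring.
rewrite H.
replace (3 * a * fib_y a X ^ 2) with (3 * (a * fib_y a X ^ 2)) by ring.
replace (3 * fib_b a X * fib_x a X ^ 2) with (3 * (fib_b a X * fib_x a X ^ 2)) by ring.
rewrite fib_y2, fib_x2 by lra. unfold jac. ring.
Qed.

Lemma is_derive_exp_comp (f : R -> R) (x l : R) :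
  is_derive f x l -> is_derive (fun t => exp (f t)) x (exp (f x) * l).
Proof.
intros H. rewrite Rmult_comm.
apply (is_derive_comp exp f x (exp (f x)) l); [apply is_derive_exp | exact H].
Qed.

Lemma is_derive_log_y (a X : R) :
  0 < X < 1 -> is_derive (log_y a) X (- 1 / (2 * (1 - X))).
Proof.
intros HX. unfold log_y. auto_derive; [lra | field; lra].
Qed.

Lemma is_derive_log_x (a X : R) :
  0 < X < 1 -> is_derive (log_x a) X ((2 - 3 * X) / (12 * X * (1 - X))).
Proof.
intros HX. unfold log_x, log_y. auto_derive; [lra | field; lra].
Qed.

(** Up to a positive factor [b] varies along the fibre at the rate [jac]: its critical points are
    the degenerate roots. *)
Lemma is_derive_fib_b (a X : R) :
  0 < X < 1 ->
  is_derive (fib_b a) X (exp (- 2 * log_x a X) / (12 * X * (1 - X)) * jac a X).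
Proof.
intros HX.
assert (D1 : is_derive (fun x => - 2 * log_x a x) X
  (- 2 * ((2 - 3 * X) / (12 * X * (1 - X)))))
  by apply (is_derive_scal (log_x a)), is_derive_log_x, HX.
assert (D2 : is_derive (fun x => 6 * log_y a x - log_x a x) X
  (6 * (- 1 / (2 * (1 - X))) - (2 - 3 * X) / (12 * X * (1 - X)))).
{ apply (is_derive_minus (fun x => 6 * log_y a x)); [|apply is_derive_log_x, HX].
  apply (is_derive_scal (log_y a)), is_derive_log_y, HX. }
apply is_derive_exp_comp in D1. apply is_derive_exp_comp in D2.
assert (D3 := is_derive_minus _ _ _ _ _ (is_derive_const 1 X) D2).
assert (D4 := is_derive_mult _ _ _ _ _ D1 D3 Rmult_comm).
eapply eq_rect; [exact D4|].
unfold jac, fib_Y.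
set (E1 := exp (-2 * log_x a X)). set (E2 := exp (6 * log_y a X - log_x a X)).
unfold minus, plus, opp, mult, zero; simpl. unfold zero; simpl.
field. lra.
Qed.

Lemma fib_b_increasing (a u v : R) :
  0 < u -> u < v -> v < 1 -> (forall x, u < x < v -> 0 < jac a x) ->
  fib_b a u < fib_b a v.
Proof.
intros Hu Huv Hv H.
apply (increasing_of_derive (fib_b a)
  (fun X => exp (- 2 * log_x a X) / (12 * X * (1 - X)) * jac a X)); [lra | |]; intros x Hx.
- apply is_derive_fib_b; lra.
- apply Rmult_lt_0_compat; [|apply H, Hx].
  apply Rdiv_lt_0_compat; [apply exp_pos|].
  repeat apply Rmult_lt_0_compat; lra.
Qed.

Lemma fib_b_decreasing (a u v : R) :
  0 < u -> u < v -> v < 1 -> (forall x, u < x < v -> jac a x < 0) ->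
  fib_b a v < fib_b a u.
Proof.
intros Hu Huv Hv H.
apply (decreasing_of_derive (fib_b a)
  (fun X => exp (- 2 * log_x a X) / (12 * X * (1 - X)) * jac a X)); [lra | |]; intros x Hx.
- apply is_derive_fib_b; lra.
- specialize (H x Hx).
  assert (0 < exp (- 2 * log_x a x) / (12 * x * (1 - x)) * - jac a x); [|lra].
  apply Rmult_lt_0_compat; [|lra].
  apply Rdiv_lt_0_compat; [apply exp_pos|].
  repeat apply Rmult_lt_0_compat; lra.
Qed.

Lemma fib_b_rolle (a u v : R) :
  0 < u -> u < v -> v < 1 -> fib_b a u = fib_b a v ->
  exists x, u < x < v /\ jac a x = 0.
Proof.
intros Hu Huv Hv He.
destruct (rolle (fib_b a)
  (fun X => exp (- 2 * log_x a X) / (12 * X * (1 - X)) * jac a X) u v Huv)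
  as [x [Hx Hz]]; [|exact He|].
- intros x Hx. apply is_derive_fib_b; lra.
- exists x. split; [exact Hx|].
  apply Rmult_integral in Hz. destruct Hz as [Hz|Hz]; [|exact Hz].
  exfalso. revert Hz. apply Rgt_not_eq.
  apply Rdiv_lt_0_compat; [apply exp_pos|].
  repeat apply Rmult_lt_0_compat; lra.
Qed.

(** Degeneracy means [fib_Y a X = yc X]. The ratio of the two sides is an exponential, so the sign
    of [jac] is that of [kap X - ln a]. *)
Lemma fib_Y_eq (a X : R) :
  0 < X < 2/3 ->
  fib_Y a X = yc X * exp (35/12 * (kap X - ln a)).
Proof.
intros HX. pose proof (yc_bounds X HX) as Hy.
unfold fib_Y. rewrite <- (exp_ln (yc X)) at 1 by lra.
rewrite <- exp_plus. f_equal. unfold log_x, log_y, kap. field.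
Qed.

Lemma jac_yc (a X : R) :
  0 < X < 2/3 -> jac a X = (27 * X + 6) * (fib_Y a X - yc X).
Proof. intros HX. unfold jac, yc. field. lra. Qed.

Lemma jac_sign (a X : R) :
  0 < X < 2/3 ->
  (ln a < kap X -> 0 < jac a X) /\ (kap X < ln a -> jac a X < 0) /\
  (jac a X = 0 -> kap X = ln a).
Proof.
intros HX. pose proof (yc_bounds X HX) as Hy.
assert (Hpos : ln a < kap X -> 0 < jac a X).
{ intros H. rewrite jac_yc, fib_Y_eq by exact HX.
  apply Rmult_lt_0_compat; [lra|].
  assert (1 < exp (35/12 * (kap X - ln a)))
    by (rewrite <- exp_0; apply exp_increasing; lra).
  assert (yc X * 1 < yc X * exp (35/12 * (kap X - ln a)))
    by (apply Rmult_lt_compat_l; lra). lra. }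
assert (Hneg : kap X < ln a -> jac a X < 0).
{ intros H. rewrite jac_yc, fib_Y_eq by exact HX.
  assert (exp (35/12 * (kap X - ln a)) < 1)
    by (rewrite <- exp_0; apply exp_increasing; lra).
  assert (yc X * exp (35/12 * (kap X - ln a)) < yc X * 1)
    by (apply Rmult_lt_compat_l; lra).
  assert (0 < (27 * X + 6) * (yc X - yc X * exp (35/12 * (kap X - ln a))))
    by (apply Rmult_lt_0_compat; lra).
  lra. }
split; [exact Hpos|]. split; [exact Hneg|]. intros H0.
destruct (Rtotal_order (kap X) (ln a)) as [H|[H|H]]; [|exact H|].
- specialize (Hneg H). lra.
- specialize (Hpos H). lra.
Qed.

Lemma jac_pos_large (a X : R) : 2/3 <= X -> 0 < jac a X.
Proof.
intros HX. unfold jac. assert (0 < fib_Y a X) by apply exp_pos.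
assert (0 < X * fib_Y a X) by (apply Rmult_lt_0_compat; lra). lra.
Qed.

(** At a degenerate root [Y = yc X], and exchanging the roles of [X] and [Y] in the formula for [a]
    gives the one for [b]. *)
Lemma fib_b_critical (a X : R) :
  0 < X < 2/3 -> kap X = ln a -> fib_b a X = dB X.
Proof.
intros HX Hk. pose proof (yc_bounds X HX) as Hy.
assert (HY : fib_Y a X = yc X).
{ rewrite fib_Y_eq, Hk by exact HX.
  replace (35/12 * (ln a - ln a)) with 0 by ring. rewrite exp_0. ring. }
assert (HlY : ln (yc X) = 6 * log_y a X - log_x a X).
{ rewrite <- HY. apply ln_exp. }
unfold fib_b, dB, dA. rewrite HY.
rewrite <- (exp_ln (1 - yc X)) by lra. rewrite <- exp_plus. f_equal.
unfold kap. rewrite yc_involutive by exact HX. rewrite HlY.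
replace (ln X) with (6 * log_x a X - log_y a X) by (unfold log_x; field). field.
Qed.

(** * Monotonicity pieces of the fibre *)

Record critical_points (a h1 h2 h3 h4 : R) : Prop := {
  cp_arc1 : 0 < h1 < cusp1;
  cp_arc2 : cusp1 < h2 < 2/9;
  cp_arc3 : 2/9 < h3 < cusp3;
  cp_arc4 : cusp3 < h4 < 2/3;
  cp_kap1 : kap h1 = ln a;
  cp_kap2 : kap h2 = ln a;
  cp_kap3 : kap h3 = ln a;
  cp_kap4 : kap h4 = ln a }.

(** [kap] falls, rises, falls and rises on the four arcs, so [kap - ln a] alternates in sign between
    consecutive [h]; thus [fib_b] rises, falls, rises, falls and rises. *)
Lemma jac_piece1 (a h1 h2 h3 h4 x : R) :
  critical_points a h1 h2 h3 h4 -> 0 < x < h1 -> 0 < jac a x.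
Proof.
intros [A1 A2 A3 A4 K1 K2 K3 K4] Hx. pose proof cusp_bounds.
apply (jac_sign a x); [lra|]. rewrite <- K1. apply kap_decreasing_arc1; lra.
Qed.

Lemma jac_piece2 (a h1 h2 h3 h4 x : R) :
  critical_points a h1 h2 h3 h4 -> h1 < x < h2 -> jac a x < 0.
Proof.
intros [A1 A2 A3 A4 K1 K2 K3 K4] Hx. pose proof cusp_bounds.
apply (jac_sign a x); [lra|].
destruct (Rle_lt_dec x cusp1).
- rewrite <- K1. apply kap_decreasing_arc1; lra.
- rewrite <- K2. apply kap_increasing_arc2; lra.
Qed.

Lemma jac_piece3 (a h1 h2 h3 h4 x : R) :
  critical_points a h1 h2 h3 h4 -> h2 < x < h3 -> 0 < jac a x.
Proof.
intros [A1 A2 A3 A4 K1 K2 K3 K4] Hx. pose proof cusp_bounds.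
apply (jac_sign a x); [lra|].
destruct (Rle_lt_dec x (2/9)).
- rewrite <- K2. apply kap_increasing_arc2; lra.
- rewrite <- K3. apply kap_decreasing_arc3; lra.
Qed.

Lemma jac_piece4 (a h1 h2 h3 h4 x : R) :
  critical_points a h1 h2 h3 h4 -> h3 < x < h4 -> jac a x < 0.
Proof.
intros [A1 A2 A3 A4 K1 K2 K3 K4] Hx. pose proof cusp_bounds.
apply (jac_sign a x); [lra|].
destruct (Rle_lt_dec x cusp3).
- rewrite <- K3. apply kap_decreasing_arc3; lra.
- rewrite <- K4. apply kap_increasing_arc4; lra.
Qed.

Lemma jac_piece5 (a h1 h2 h3 h4 x : R) :
  critical_points a h1 h2 h3 h4 -> h4 < x < 1 -> 0 < jac a x.
Proof.
intros [A1 A2 A3 A4 K1 K2 K3 K4] Hx. pose proof cusp_bounds.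
destruct (Rle_lt_dec (2/3) x); [apply jac_pos_large; assumption|].
apply (jac_sign a x); [lra|]. rewrite <- K4. apply kap_increasing_arc4; lra.
Qed.

(** * Behaviour of [fib_b] at the two ends of the fibre *)

Lemma exp_nondecreasing (x y : R) : x <= y -> exp x <= exp y.
Proof. intros [H| ->]; [apply Rlt_le, exp_increasing, H | apply Rle_refl]. Qed.

Lemma ln2_le_1 : ln 2 <= 1.
Proof.
rewrite <- (ln_exp 1). apply ln_le; [lra|]. pose proof (exp_ineq1_le 1). lra.
Qed.

(** As [X] tends to 0 so does [x], while [y] does not; hence [Y = y^6 / x] eventually exceeds 1 and
    [fib_b] is at most 0. *)
Lemma fib_b_below_near_0 (a b h : R) :
  0 < b -> 0 < h < 1 -> exists X, 0 < X < h /\ fib_b a X < b.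
Proof.
intros Hb Hh.
(* [ln Y] is [35/12 * (ln (1 - X) - ln a) - ln X / 6]; with [ln (1 - X) >= -1] and [ln X <= - M] it
   is nonnegative. *)
set (M := 35/2 * (1 + Rabs (ln a))).
pose proof (Rabs_pos (ln a)) as Ha0. pose proof (Rle_abs (ln a)) as Ha1.
assert (HM : 0 <= M) by (unfold M; lra).
assert (HeM : 0 < exp (- M) <= 1).
{ split; [apply exp_pos|]. rewrite <- exp_0. apply exp_nondecreasing. lra. }
exists (h / 2 * exp (- M)). set (X := h / 2 * exp (- M)).
assert (HX : 0 < X <= h / 2).
{ unfold X. split; [apply Rmult_lt_0_compat; lra|].
  rewrite <- (Rmult_1_r (h / 2)) at 2. apply Rmult_le_compat_l; lra. }
split; [lra|].
assert (L1 : - 1 <= ln (1 - X)).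
{ pose proof ln2_le_1. apply Rle_trans with (ln (/ 2)).
  - rewrite ln_Rinv by lra. lra.
  - apply ln_le; lra. }
assert (L2 : ln X <= - M).
{ rewrite <- (ln_exp (- M)). apply ln_le; [lra|]. unfold X.
  rewrite <- (Rmult_1_l (exp (- M))) at 2. apply Rmult_le_compat_r; lra. }
assert (HY : 1 <= fib_Y a X).
{ unfold fib_Y. rewrite <- exp_0. apply exp_nondecreasing. unfold log_x, log_y, M in *. lra. }
unfold fib_b. pose proof (exp_pos (-2 * log_x a X)).
assert (0 <= exp (-2 * log_x a X) * (fib_Y a X - 1)) by (apply Rmult_le_pos; lra).
lra.
Qed.

(** As [X] tends to 1, both [x] and [Y] tend to 0, so [b = (1 - Y) / x^2] is unbounded. *)
Lemma fib_b_above_near_1 (a b h : R) :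
  0 < b -> 0 < h < 1 -> exists X, h < X < 1 /\ b < fib_b a X.
Proof.
intros Hb Hh.
(* The summand 1 forces [Y <= 1/2], and the multiple 6 of [ln (2 * b)] forces [1 / x^2 > 2 * b]. *)
set (M := Rabs (ln a) + 6 * Rabs (ln (2 * b)) + 1).
pose proof (Rabs_pos (ln a)) as Ha0. pose proof (Rle_abs (- ln a)) as Ha1.
rewrite Rabs_Ropp in Ha1.
pose proof (Rabs_pos (ln (2 * b))) as Hb0. pose proof (Rle_abs (ln (2 * b))) as Hb1.
assert (HM : 0 <= M) by (unfold M; lra).
assert (HeM : 0 < exp (- M) <= 1).
{ split; [apply exp_pos|]. rewrite <- exp_0. apply exp_nondecreasing. lra. }
set (e := (1 - h) / 2 * exp (- M)).
assert (He : 0 < e <= (1 - h) / 2).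
{ unfold e. split; [apply Rmult_lt_0_compat; lra|].
  rewrite <- (Rmult_1_r ((1 - h) / 2)) at 2. apply Rmult_le_compat_l; lra. }
exists (1 - e). set (X := 1 - e).
assert (HX : h < X < 1) by (unfold X; lra).
split; [exact HX|].
pose proof ln2_le_1 as L0.
assert (L1 : - ln 2 <= ln X).
{ rewrite <- ln_Rinv by lra. apply ln_le; unfold X; lra. }
assert (L1' : ln X <= 0) by (rewrite <- ln_1; apply ln_le; lra).
assert (L2 : ln (1 - X) <= - M).
{ rewrite <- (ln_exp (- M)). unfold X. replace (1 - (1 - e)) with e by ring.
  apply ln_le; [lra|]. unfold e.
  rewrite <- (Rmult_1_l (exp (- M))) at 2. apply Rmult_le_compat_r; lra. }
pose proof ln_lt_2 as L3.
assert (HY : fib_Y a X <= /2).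
{ unfold fib_Y. rewrite <- (exp_ln (/ 2)) by lra. apply exp_nondecreasing.
  rewrite ln_Rinv by lra. unfold log_x, log_y, M in *. lra. }
assert (Hx : 2 * b < exp (-2 * log_x a X)).
{ rewrite <- (exp_ln (2 * b)) by lra. apply exp_increasing.
  unfold log_x, log_y, M in *. lra. }
unfold fib_b.
assert (exp (-2 * log_x a X) * / 2 <= exp (-2 * log_x a X) * (1 - fib_Y a X))
  by (apply Rmult_le_compat_l; lra).
lra.
Qed.

(** * Exactly five roots from the separation conditions *)

Lemma fib_b_ivt_incr (a b u v : R) :
  0 < u -> u < v -> v < 1 -> fib_b a u < b -> b < fib_b a v ->
  exists X, u < X < v /\ fib_b a X = b.
Proof.
intros Hu Huv Hv H H'.
apply (ivt_incr (fib_b a)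
  (fun X => exp (- 2 * log_x a X) / (12 * X * (1 - X)) * jac a X)); [lra | | lra].
intros x Hx. apply is_derive_fib_b; lra.
Qed.

Lemma fib_b_ivt_decr (a b u v : R) :
  0 < u -> u < v -> v < 1 -> fib_b a v < b -> b < fib_b a u ->
  exists X, u < X < v /\ fib_b a X = b.
Proof.
intros Hu Huv Hv H H'.
apply (ivt_decr (fib_b a)
  (fun X => exp (- 2 * log_x a X) / (12 * X * (1 - X)) * jac a X)); [lra | | lra].
intros x Hx. apply is_derive_fib_b; lra.
Qed.

(** [b] lies below the local maxima of [fib_b a] at [h1] and [h3] and above its local minima at [h2]
    and [h4]. *)
Definition separated (a b h1 h2 h3 h4 : R) : Prop :=
  critical_points a h1 h2 h3 h4 /\
  b < fib_b a h1 /\ fib_b a h2 < b /\ b < fib_b a h3 /\ fib_b a h4 < b.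

(** [yc] maps arc 2 to arc 3 reversing the order, and [kap] decreases there; likewise below for arcs
    4 and 1. *)
Lemma dB_increasing_arc2 (u v : R) : cusp1 <= u -> u < v -> v <= 2/9 -> dB u < dB v.
Proof.
intros. pose proof cusp_bounds. apply dA_lt, kap_decreasing_arc3.
- rewrite <- yc_cusp2. destruct (Req_dec v (2/9)) as [->|]; [lra|].
  apply Rlt_le, yc_decreasing; lra.
- apply yc_decreasing; lra.
- rewrite <- yc_cusp1. destruct (Req_dec u cusp1) as [->|]; [lra|].
  apply Rlt_le, yc_decreasing; lra.
Qed.

Lemma dB_increasing_arc4 (u v : R) : cusp3 <= u -> u < v -> v < 2/3 -> dB u < dB v.
Proof.
intros. pose proof cusp_bounds. apply dA_lt, kap_decreasing_arc1.
- apply yc_bounds; lra.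
- apply yc_decreasing; lra.
- rewrite <- yc_cusp3. destruct (Req_dec u cusp3) as [->|]; [lra|].
  apply Rlt_le, yc_decreasing; lra.
Qed.

Lemma dA_eq_kap (X a : R) : dA X = a -> kap X = ln a.
Proof. intros <-. unfold dA. rewrite ln_exp. reflexivity. Qed.

(* The involution [yc] reflects the curve in the diagonal, exchanging arcs 1 and 4 and arcs
   2 and 3; so the lower constraints on [(a, b)] are the upper constraints on [(b, a)]. *)
Lemma separated_of_below (a b : R) :
  below_upper_arcs a b -> below_upper_arcs b a ->
  exists h1 h2 h3 h4, separated a b h1 h2 h3 h4.
Proof.
intros [(h1 & Hh1 & HA1 & HB1) (h3 & Hh3 & HA3 & HB3)]
       [(z1 & Hz1 & ZA1 & ZB1) (z3 & Hz3 & ZA3 & ZB3)].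
pose proof cusp_bounds as [Hc1 Hc3].
assert (Y3 : cusp1 < yc z3 < 2/9).
{ split; [rewrite <- yc_cusp3 | rewrite <- yc_cusp2]; apply yc_decreasing; lra. }
assert (Y1 : cusp3 < yc z1 < 2/3).
{ split; [|apply yc_bounds; lra].
  rewrite <- yc_cusp1. apply yc_decreasing; lra. }
assert (E1 : dB (yc z1) = b) by (unfold dB; rewrite yc_involutive by lra; exact ZA1).
assert (E3 : dB (yc z3) = b) by (unfold dB; rewrite yc_involutive by lra; exact ZA3).
change (dB z1) with (dA (yc z1)) in ZB1. change (dB z3) with (dA (yc z3)) in ZB3.
assert (C1 : dA cusp1 < a) by (rewrite <- HA1; apply dA_lt, kap_decreasing_arc1; lra).
assert (C3 : dA cusp3 < a) by (rewrite <- HA3; apply dA_lt, kap_decreasing_arc3; lra).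
(* At [yc z3] arc 2 has ordinate [b] and an abscissa greater than [a]; so it passes over [a]
   earlier, at a smaller ordinate. The same holds for arc 4 and [yc z1]. *)
destruct (ivt_incr dA (fun x => dA x * dkap x) cusp1 (yc z3) a) as (h2 & Hh2 & HA2); try lra.
{ intros; apply is_derive_dA; lra. }
destruct (ivt_incr dA (fun x => dA x * dkap x) cusp3 (yc z1) a) as (h4 & Hh4 & HA4); try lra.
{ intros; apply is_derive_dA; lra. }
exists h1, h2, h3, h4.
assert (HB2 : dB h2 < b) by (rewrite <- E3; apply dB_increasing_arc2; lra).
assert (HB4 : dB h4 < b) by (rewrite <- E1; apply dB_increasing_arc4; lra).
apply dA_eq_kap in HA1, HA2, HA3, HA4.
split; [constructor; assumption || lra|].
rewrite !fib_b_critical by (assumption || lra). lra.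
Qed.

(** On each of the five monotone pieces the level [b] is crossed, by the intermediate value theorem,
    and only once, by monotonicity. *)
Lemma interlaced_roots (a b h1 h2 h3 h4 : R) :
  0 < b -> separated a b h1 h2 h3 h4 ->
  exists x1 x2 x3 x4 x5,
    (0 < x1 < h1 /\ h1 < x2 < h2 /\ h2 < x3 < h3 /\ h3 < x4 < h4 /\ h4 < x5 < 1) /\
    forall X, 0 < X < 1 -> (fib_b a X = b <-> In X (x1 :: x2 :: x3 :: x4 :: x5 :: nil)).
Proof.
intros Hb (Hcp & B1 & B2 & B3 & B4).
pose proof Hcp as [A1 A2 A3 A4 _ _ _ _].
pose proof cusp_bounds as [Hc1 Hc3].
destruct (fib_b_below_near_0 a b h1 Hb) as (u & Hu & Bu); [lra|].
destruct (fib_b_above_near_1 a b h4 Hb) as (v & Hv & Bv); [lra|].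
destruct (fib_b_ivt_incr a b u h1) as (x1 & I1 & E1); try lra.
destruct (fib_b_ivt_decr a b h1 h2) as (x2 & I2 & E2); try lra.
destruct (fib_b_ivt_incr a b h2 h3) as (x3 & I3 & E3); try lra.
destruct (fib_b_ivt_decr a b h3 h4) as (x4 & I4 & E4); try lra.
destruct (fib_b_ivt_incr a b h4 v) as (x5 & I5 & E5); try lra.
exists x1, x2, x3, x4, x5. split; [repeat split; lra|].
assert (Uinc : forall l r, 0 <= l -> r <= 1 -> (forall x, l < x < r -> 0 < jac a x) ->
  forall x y, l < x < r -> l < y < r -> fib_b a x = fib_b a y -> x = y).
{ intros l r Hl Hr HJ x y Hx Hy He.
  destruct (Rtotal_order x y) as [H|[H|H]]; [|exact H|].
  - assert (fib_b a x < fib_b a y) by (apply fib_b_increasing; try lra; intros; apply HJ; lra).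
    lra.
  - assert (fib_b a y < fib_b a x) by (apply fib_b_increasing; try lra; intros; apply HJ; lra).
    lra. }
assert (Udec : forall l r, 0 <= l -> r <= 1 -> (forall x, l < x < r -> jac a x < 0) ->
  forall x y, l < x < r -> l < y < r -> fib_b a x = fib_b a y -> x = y).
{ intros l r Hl Hr HJ x y Hx Hy He.
  destruct (Rtotal_order x y) as [H|[H|H]]; [|exact H|].
  - assert (fib_b a y < fib_b a x) by (apply fib_b_decreasing; try lra; intros; apply HJ; lra).
    lra.
  - assert (fib_b a x < fib_b a y) by (apply fib_b_decreasing; try lra; intros; apply HJ; lra).
    lra. }
intros X HX. split; [|intros [<-|[<-|[<-|[<-|[<-|[]]]]]]; assumption].
intros EX. simpl.
(* A solution locates itself in one piece; it is none of the [h], where the value differs from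
   [b]. *)
destruct (Rtotal_order X h1) as [H|[->|H]]; [|lra|].
{ left. apply (Uinc 0 h1); try lra.
  intros x Hx. exact (jac_piece1 _ _ _ _ _ x Hcp Hx). }
destruct (Rtotal_order X h2) as [H'|[->|H']]; [|lra|].
{ right; left. apply (Udec h1 h2); try lra.
  intros x Hx. exact (jac_piece2 _ _ _ _ _ x Hcp Hx). }
destruct (Rtotal_order X h3) as [H''|[->|H'']]; [|lra|].
{ right; right; left. apply (Uinc h2 h3); try lra.
  intros x Hx. exact (jac_piece3 _ _ _ _ _ x Hcp Hx). }
destruct (Rtotal_order X h4) as [H'''|[->|H''']]; [|lra|].
{ do 3 right; left. apply (Udec h3 h4); try lra.
  intros x Hx. exact (jac_piece4 _ _ _ _ _ x Hcp Hx). }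
do 4 right; left. apply (Uinc h4 1); try lra.
intros x Hx. exact (jac_piece5 _ _ _ _ _ x Hcp Hx).
Qed.

Definition exactly_five (a b : R) (l : list (R * R)) : Prop :=
  NoDup l /\ length l = 5%nat /\
  (forall p, (in_pos_quadrant p /\ is_root a b p) <-> In p l) /\
  List.Forall (non_degenerate a b) l.

Definition fib_point (a X : R) : R * R := (fib_x a X, fib_y a X).

Lemma fib_point_inj (a X X' : R) :
  0 < X < 1 -> 0 < X' < 1 -> fib_point a X = fib_point a X' -> X = X'.
Proof.
intros HX HX' H. injection H as Ex Ey.
pose proof (fib_x6 a X) as H1. pose proof (fib_x6 a X') as H2.
rewrite Ex, Ey in H1. assert (0 < fib_y a X') by apply exp_pos.
apply Rmult_eq_reg_r with (fib_y a X'); lra.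
Qed.

Lemma exactly_five_of_separated (a b h1 h2 h3 h4 : R) :
  0 < a -> 0 < b -> separated a b h1 h2 h3 h4 -> exists l, exactly_five a b l.
Proof.
intros Ha Hb Hs.
destruct (interlaced_roots a b h1 h2 h3 h4 Hb Hs)
  as (x1 & x2 & x3 & x4 & x5 & (I1 & I2 & I3 & I4 & I5) & HI).
destruct Hs as (Hcp & _). pose proof Hcp as [A1 A2 A3 A4 _ _ _ _].
pose proof cusp_bounds as [Hc1 Hc3].
set (xs := x1 :: x2 :: x3 :: x4 :: x5 :: nil) in *.
assert (Hxs : forall X, In X xs -> 0 < X < 1 /\ jac a X <> 0).
{ unfold xs. intros X [<-|[<-|[<-|[<-|[<-|[]]]]]]; (split; [lra|]).
  - apply Rgt_not_eq, (jac_piece1 _ _ _ _ _ _ Hcp I1).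
  - apply Rlt_not_eq, (jac_piece2 _ _ _ _ _ _ Hcp I2).
  - apply Rgt_not_eq, (jac_piece3 _ _ _ _ _ _ Hcp I3).
  - apply Rlt_not_eq, (jac_piece4 _ _ _ _ _ _ Hcp I4).
  - apply Rgt_not_eq, (jac_piece5 _ _ _ _ _ _ Hcp I5). }
exists (map (fib_point a) xs).
split; [|split; [|split]]; [| |intros p; split|].
- apply NoDup_map_NoDup_ForallPairs.
  + intros X X' HX HX'. apply fib_point_inj; apply Hxs; assumption.
  + unfold xs. repeat constructor; simpl; lra.
- reflexivity.
- intros [Hp Hr]. destruct p as [x y]. destruct Hp as [Hx Hy]; simpl in Hx, Hy.
  destruct (root_fib a b x y Ha Hx Hy Hr) as (HX & Ex & Ey & EB).
  apply in_map_iff. exists (x^6 / y). split.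
  + unfold fib_point. rewrite <- Ex, <- Ey. reflexivity.
  + apply HI; assumption.
- intros Hp. apply in_map_iff in Hp. destruct Hp as (X & <- & HX).
  split; [apply fib_pos|].
  destruct (Hxs X HX) as [HX1 _]. apply (HI X HX1) in HX. rewrite <- HX.
  apply fib_is_root; assumption.
- apply Forall_map, Forall_forall. intros X HX.
  destruct (Hxs X HX) as [HX1 HJ]. apply (HI X HX1) in HX. rewrite <- HX.
  unfold non_degenerate, fib_point. rewrite jacobian_det_fib; assumption.
Qed.

Lemma exactly_five_of_below (a b : R) :
  below_upper_arcs a b -> below_upper_arcs b a -> exists l, exactly_five a b l.
Proof.
intros H1 H2.
destruct (separated_of_below a b H1 H2) as (h1 & h2 & h3 & h4 & Hs).
apply (exactly_five_of_separated a b h1 h2 h3 h4); [| |exact Hs].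
- destruct H1 as [(X & _ & <- & _) _]. apply dA_pos.
- destruct H2 as [(X & _ & <- & _) _]. apply dA_pos.
Qed.

Lemma sqr_dist_separated (p : R * R) (l : list (R * R)) :
  exists eps, 0 < eps /\ forall q, In q l ->
    (fst q - fst p)^2 + (snd q - snd p)^2 < eps^2 -> q = p.
Proof.
induction l as [|r l [e [He IH]]].
- exists 1. split; [lra|]. intros q [].
- set (d := (fst r - fst p)^2 + (snd r - snd p)^2).
  assert (Hd : r = p \/ 0 < d).
  { destruct r as [r1 r2], p as [p1 p2]; unfold d; simpl fst; simpl snd.
    pose proof (pow2_ge_0 (r1 - p1)). pose proof (pow2_ge_0 (r2 - p2)).
    destruct (Req_dec r1 p1) as [->|N1].
    - destruct (Req_dec r2 p2) as [->|N2]; [left; reflexivity|].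
      right. assert (0 < (r2 - p2)^2) by (apply pow2_gt_0; lra). lra.
    - right. assert (0 < (r1 - p1)^2) by (apply pow2_gt_0; lra). lra. }
  destruct Hd as [->|Hd].
  + exists e. split; [exact He|]. intros q [<-|Hq]; [reflexivity|apply IH, Hq].
  + assert (Hs : 0 < sqrt d) by (apply sqrt_lt_R0, Hd).
    exists (Rmin e (sqrt d)). split; [apply Rmin_glb_lt; assumption|].
    pose proof (Rmin_l e (sqrt d)). pose proof (Rmin_r e (sqrt d)).
    assert (0 < Rmin e (sqrt d)) by (apply Rmin_glb_lt; assumption).
    intros q [<-|Hq] Hlt.
    * exfalso. assert (Rmin e (sqrt d) ^ 2 <= sqrt d ^ 2) by (apply pow_incr; lra).
      rewrite pow2_sqrt in H2 by lra. fold d in Hlt. lra.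
    * apply IH; [exact Hq|]. assert (Rmin e (sqrt d) ^ 2 <= e ^ 2) by (apply pow_incr; lra).
      lra.
Qed.

(** Isolation is among all real roots, while the list contains the positive ones; the disc is
    therefore also kept inside the quadrant. *)
Lemma E3_of_exactly_five (a b : R) (l : list (R * R)) :
  exactly_five a b l -> E3 (a, b).
Proof.
intros (Hnd & Hlen & Hl & Hdeg). exists l. split; [exact Hnd|]. split; [lia|].
apply Forall_forall. intros p Hp. simpl fst; simpl snd.
destruct (proj2 (Hl p) Hp) as [Hpos Hroot].
split; [exact Hpos|]. split; [|exact (proj1 (Forall_forall _ _) Hdeg p Hp)].
split; [exact Hroot|].
destruct (sqr_dist_separated p l) as [e [He Hsep]].
destruct Hpos as [Hx Hy].
(* The radius is at most the separation [e] and the distances of [p] to both axes. *)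
set (d := Rmin e (Rmin (fst p) (snd p))).
assert (Hd : 0 < d) by (repeat apply Rmin_glb_lt; assumption).
assert (Hde : d <= e) by apply Rmin_l.
assert (Hdx : d <= fst p) by (eapply Rle_trans; [apply Rmin_r|apply Rmin_l]).
assert (Hdy : d <= snd p) by (eapply Rle_trans; [apply Rmin_r|apply Rmin_r]).
exists d. split; [exact Hd|]. intros q Hq Hlt.
pose proof (pow2_ge_0 (fst q - fst p)). pose proof (pow2_ge_0 (snd q - snd p)).
assert (Habs : forall u, u^2 < d^2 -> - d < u).
{ intros u Hu. destruct (Rlt_le_dec (- d) u) as [|Hle]; [assumption|]. nra. }
apply Hsep.
- apply Hl. split; [|exact Hq]. split.
  + assert (- d < fst q - fst p) by (apply Habs; lra). lra.
  + assert (- d < snd q - snd p) by (apply Habs; lra). lra.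
- assert (d^2 <= e^2) by (apply pow_incr; lra). lra.
Qed.

(** * Five roots force the separation conditions *)

Definition five_roots (a b : R) : Prop :=
  exists l : list (R * R), NoDup l /\ (5 <= length l)%nat /\
    forall p, In p l -> in_pos_quadrant p /\ is_root a b p.

Definition swap (p : R * R) : R * R := (snd p, fst p).

Lemma five_roots_sym (a b : R) : five_roots a b -> five_roots b a.
Proof.
intros (l & Hnd & Hlen & Hl). exists (map swap l). split; [|split].
- apply NoDup_map_NoDup_ForallPairs; [|exact Hnd].
  intros [x y] [x' y'] _ _ E. injection E as -> ->. reflexivity.
- rewrite length_map. exact Hlen.
- intros p Hp. apply in_map_iff in Hp. destruct Hp as ([x y] & <- & Hp).
  destruct (Hl _ Hp) as [[Hx Hy] [E1 E2]]. split; split; assumption.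
Qed.

(** * Positive roots form an antichain, and [a] is positive *)

Lemma pow_lt_mono (x y : R) (n : nat) : 0 <= x < y -> (0 < n)%nat -> x^n < y^n.
Proof.
intros Hxy Hn. destruct n as [|n]; [lia|]. clear Hn.
induction n as [|n IH]; [simpl; lra|].
change (x^(S (S n))) with (x * x^(S n)). change (y^(S (S n))) with (y * y^(S n)).
apply Rmult_le_0_lt_compat; try lra. apply pow_le; lra.
Qed.

Lemma pow_le_reg (x y : R) (n : nat) : 0 <= y -> (0 < n)%nat -> x^n <= y^n -> x <= y.
Proof.
intros Hy Hn H. destruct (Rlt_le_dec y x) as [Hlt|]; [|assumption].
pose proof (pow_lt_mono y x n ltac:(lra) Hn). lra.
Qed.

(** Division by [y^3] gives [x^6 / y^3 = 1 / y^2 - c], which decreases in [y]. *)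
Lemma root_ratio_bound (c x y x' y' : R) :
  0 < y -> y <= y' -> x^6 + c * y^3 - y = 0 -> x'^6 + c * y'^3 - y' = 0 ->
  x'^6 * y^3 <= x^6 * y'^3.
Proof.
intros Hy Hyy E E'.
replace (x^6) with (y - c * y^3) by lra. replace (x'^6) with (y' - c * y'^3) by lra.
assert (0 <= y * y' * (y'^2 - y^2)).
{ repeat apply Rmult_le_pos; try lra.
  assert (y^2 <= y'^2) by (apply pow_incr; lra). lra. }
replace ((y' - c * y'^3) * y^3) with (y' * y^3 - c * y^3 * y'^3) by ring.
replace ((y - c * y^3) * y'^3) with (y * y'^3 - c * y^3 * y'^3) by ring.
lra.
Qed.

Lemma roots_antichain (a b x y x' y' : R) :
  0 < x -> 0 < y -> x <= x' -> y <= y' ->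
  is_root a b (x, y) -> is_root a b (x', y') -> (x, y) = (x', y').
Proof.
intros Hx Hy Hxx Hyy [E1 E2] [E1' E2'].
unfold H1, H2 in *; simpl fst in *; simpl snd in *.
pose proof (root_ratio_bound a x y x' y' Hy Hyy E1 E1') as B1.
pose proof (root_ratio_bound b y x y' x' Hx Hxx E2 E2') as B2.
assert (P : forall u n, 0 < u -> 0 < u^n) by (intros; apply pow_lt; assumption).
(* The square of the first bound combined with the second eliminates [y] and [y']. *)
assert (Hx9 : x'^9 <= x^9).
{ assert (S1 : (x'^6 * y^3)^2 <= (x^6 * y'^3)^2).
  { apply pow_incr. split; [|exact B1]. apply Rlt_le, Rmult_lt_0_compat; apply P; lra. }
  assert (S2 : x^12 * (y'^6 * x^3) <= x^12 * (y^6 * x'^3))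
    by (apply Rmult_le_compat_l; [apply Rlt_le, P, Hx | exact B2]).
  assert (S3 : (x'^6 * y^3)^2 * x^3 <= (x^6 * y'^3)^2 * x^3)
    by (apply Rmult_le_compat_r; [apply Rlt_le, P, Hx | exact S1]).
  apply Rmult_le_reg_r with (y^6 * (x^3 * x'^3)).
  { apply Rmult_lt_0_compat; [|apply Rmult_lt_0_compat]; apply P; lra. }
  apply Rle_trans with ((x'^6 * y^3)^2 * x^3); [right; ring|].
  apply Rle_trans with (1 := S3).
  apply Rle_trans with (x^12 * (y'^6 * x^3)); [right; ring|].
  apply Rle_trans with (1 := S2). right; ring. }
assert (Ex : x' = x) by (apply Rle_antisym; [apply (pow_le_reg _ _ 9); [lra|lia|exact Hx9]|lra]).
subst x'. apply Rmult_le_reg_r in B2; [|apply P, Hx].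
apply (pow_le_reg y' y 6) in B2; [|lra|lia].
f_equal; lra.
Qed.

(** For [a <= 0] the first equation makes [x] increase with [y], so two positive roots would be
    comparable, against the antichain property. *)
Lemma first_coeff_pos (a b : R) : five_roots a b -> 0 < a.
Proof.
intros (l & Hnd & Hlen & Hl).
destruct (Rlt_le_dec 0 a) as [|Ha]; [assumption|exfalso].
destruct l as [|[x y] [|[x' y'] l]]; try (simpl in Hlen; lia).
assert (Key : forall x y x' y', in_pos_quadrant (x, y) -> in_pos_quadrant (x', y') ->
  is_root a b (x, y) -> is_root a b (x', y') -> y <= y' -> (x, y) = (x', y')).
{ clear x y x' y' Hnd Hlen Hl. intros x y x' y' [Hx Hy] [Hx' Hy'] R R' Hyy.
  simpl in Hx, Hy, Hx', Hy'.
  apply (roots_antichain a b); try assumption.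
  destruct R as [E _], R' as [E' _]. unfold H1 in *; simpl fst in *; simpl snd in *.
  apply (pow_le_reg x x' 6); [lra|lia|].
  assert (y^3 <= y'^3) by (apply pow_incr; lra).
  assert (0 <= - a * (y'^3 - y^3)) by (apply Rmult_le_pos; lra). lra. }
destruct (Hl (x, y)) as [P R]; [left; reflexivity|].
destruct (Hl (x', y')) as [P' R']; [right; left; reflexivity|].
apply NoDup_cons_iff in Hnd. destruct Hnd as [Hni _]. apply Hni. left.
destruct (Rle_lt_dec y y').
- symmetry. apply Key; assumption.
- apply Key; try assumption. lra.
Qed.

(** * Sorting five roots along the fibre *)

Lemma extract_min (l : list R) :
  NoDup l -> l <> nil ->
  exists m l', In m l /\ NoDup l' /\ length l = S (length l') /\ incl l' l /\
    forall x, In x l' -> m < x.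
Proof.
induction l as [|x l IH]; intros Hnd Hne; [congruence|].
apply NoDup_cons_iff in Hnd. destruct Hnd as [Hni Hnd].
destruct l as [|y l0].
{ exists x, nil. repeat split; [left; reflexivity | constructor | intros ? [] | intros ? []]. }
set (l := y :: l0) in *.
destruct IH as (m & l' & Hm & Hnd' & Hlen & Hincl & Hlt); [exact Hnd | discriminate |].
destruct (Rtotal_order x m) as [H|[H|H]].
- exists x, (m :: l'). split; [left; reflexivity|]. split; [|split; [|split]].
  + constructor; [|exact Hnd']. intros Hin. specialize (Hlt m Hin). lra.
  + simpl length at 2. rewrite <- Hlen. reflexivity.
  + intros z [<-|Hz]; right; [exact Hm | apply Hincl, Hz].
  + intros z [<-|Hz]; [exact H|]. specialize (Hlt z Hz). lra.
- subst m. contradiction.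
- exists m, (x :: l'). split; [right; exact Hm|]. split; [|split; [|split]].
  + constructor; [|exact Hnd']. intros Hin. apply Hni, Hincl, Hin.
  + simpl length. simpl length in Hlen. rewrite Hlen. reflexivity.
  + intros z [<-|Hz]; [left; reflexivity | right; apply Hincl, Hz].
  + intros z [<-|Hz]; [exact H | apply Hlt, Hz].
Qed.

Lemma sorted_five (l : list R) :
  NoDup l -> (5 <= length l)%nat ->
  exists x1 x2 x3 x4 x5, x1 < x2 < x3 /\ x3 < x4 < x5 /\
    In x1 l /\ In x2 l /\ In x3 l /\ In x4 l /\ In x5 l.
Proof.
intros Hnd Hlen.
assert (Hne : forall l' : list R, (0 < length l')%nat -> l' <> nil)
  by (intros [|? ?]; simpl; [lia | discriminate]).
destruct (extract_min l) as (x1 & l1 & I1 & N1 & L1 & S1 & M1); [auto | apply Hne; lia |].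
destruct (extract_min l1) as (x2 & l2 & I2 & N2 & L2 & S2 & M2); [auto | apply Hne; lia |].
destruct (extract_min l2) as (x3 & l3 & I3 & N3 & L3 & S3 & M3); [auto | apply Hne; lia |].
destruct (extract_min l3) as (x4 & l4 & I4 & N4 & L4 & S4 & M4); [auto | apply Hne; lia |].
destruct (extract_min l4) as (x5 & l5 & I5 & N5 & L5 & S5 & M5); [auto | apply Hne; lia |].
exists x1, x2, x3, x4, x5.
repeat split; auto 10.
Qed.

Lemma sorted_fibre_roots (a b : R) :
  0 < a -> five_roots a b ->
  exists x1 x2 x3 x4 x5, 0 < x1 < x2 /\ x2 < x3 < x4 /\ x4 < x5 < 1 /\
    fib_b a x1 = b /\ fib_b a x2 = b /\ fib_b a x3 = b /\ fib_b a x4 = b /\ fib_b a x5 = b.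
Proof.
intros Ha (l & Hnd & Hlen & Hl).
set (f := fun p : R * R => fst p ^ 6 / snd p).
assert (Hf : forall p, In p l ->
  0 < f p < 1 /\ p = fib_point a (f p) /\ fib_b a (f p) = b).
{ intros [x y] Hp. destruct (Hl _ Hp) as [[Hx Hy] Hr]. simpl in Hx, Hy.
  destruct (root_fib a b x y Ha Hx Hy Hr) as (HX & Ex & Ey & EB).
  split; [exact HX|]. split; [|exact EB].
  unfold fib_point, f; simpl fst; simpl snd. rewrite <- Ex, <- Ey. reflexivity. }
destruct (sorted_five (map f l)) as (x1 & x2 & x3 & x4 & x5 & O1 & O2 & I1 & I2 & I3 & I4 & I5).
- apply NoDup_map_NoDup_ForallPairs; [|exact Hnd].
  intros p q Hp Hq E. destruct (Hf p Hp) as (_ & -> & _). destruct (Hf q Hq) as (_ & -> & _).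
  rewrite E. reflexivity.
- rewrite length_map. exact Hlen.
- assert (Hf' : forall X, In X (map f l) -> 0 < X < 1 /\ fib_b a X = b).
  { intros X HX. apply in_map_iff in HX. destruct HX as (p & <- & Hp).
    destruct (Hf p Hp) as (B & _ & E). split; assumption. }
  exists x1, x2, x3, x4, x5.
  destruct (Hf' _ I1), (Hf' _ I2), (Hf' _ I3), (Hf' _ I4), (Hf' _ I5).
  repeat split; tauto.
Qed.

(** Rolle's theorem puts four critical points between the five roots, and these must lie one on each
    arc; [b] is below the values at the first and the third. *)
Lemma below_upper_arcs_of_five_roots (a b : R) : five_roots a b -> below_upper_arcs a b.
Proof.
intros H5. pose proof (first_coeff_pos a b H5) as Ha.
destruct (sorted_fibre_roots a b Ha H5)
  as (x1 & x2 & x3 & x4 & x5 & O1 & O2 & O3 & B1 & B2 & B3 & B4 & B5).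
pose proof cusp_bounds as [Hc1 Hc3].
destruct (fib_b_rolle a x1 x2) as (h1 & I1 & J1); try lra.
destruct (fib_b_rolle a x2 x3) as (h2 & I2 & J2); try lra.
destruct (fib_b_rolle a x3 x4) as (h3 & I3 & J3); try lra.
destruct (fib_b_rolle a x4 x5) as (h4 & I4 & J4); try lra.
assert (Hcrit : forall h, 0 < h -> jac a h = 0 -> h < 2/3 /\ kap h = ln a).
{ intros h Hh HJ. destruct (Rlt_le_dec h (2/3)) as [Hl|Hl].
  - split; [exact Hl|]. apply (jac_sign a h); [lra | exact HJ].
  - pose proof (jac_pos_large a h Hl). lra. }
destruct (Hcrit h1 ltac:(lra) J1) as [L1 K1].
destruct (Hcrit h2 ltac:(lra) J2) as [L2 K2].
destruct (Hcrit h3 ltac:(lra) J3) as [L3 K3].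
destruct (Hcrit h4 ltac:(lra) J4) as [L4 K4].
(* [kap] is injective on each arc, so no two consecutive critical points share one. *)
assert (G2 : cusp1 < h2).
{ destruct (Rlt_le_dec cusp1 h2) as [|Hle]; [assumption|].
  pose proof (kap_decreasing_arc1 h1 h2 ltac:(lra) ltac:(lra) Hle). lra. }
assert (G3 : 2/9 < h3).
{ destruct (Rlt_le_dec (2/9) h3) as [|Hle]; [assumption|].
  pose proof (kap_increasing_arc2 h2 h3 ltac:(lra) ltac:(lra) Hle). lra. }
assert (G4 : cusp3 < h4).
{ destruct (Rlt_le_dec cusp3 h4) as [|Hle]; [assumption|].
  pose proof (kap_decreasing_arc3 h3 h4 ltac:(lra) ltac:(lra) Hle). lra. }
assert (F3 : h3 < cusp3).
{ destruct (Rlt_le_dec h3 cusp3) as [|Hle]; [assumption|].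
  pose proof (kap_increasing_arc4 h3 h4 Hle ltac:(lra) L4). lra. }
assert (F2 : h2 < 2/9).
{ destruct (Rlt_le_dec h2 (2/9)) as [|Hle]; [assumption|].
  pose proof (kap_decreasing_arc3 h2 h3 Hle ltac:(lra) ltac:(lra)). lra. }
assert (F1 : h1 < cusp1).
{ destruct (Rlt_le_dec h1 cusp1) as [|Hle]; [assumption|].
  pose proof (kap_increasing_arc2 h1 h2 Hle ltac:(lra) ltac:(lra)). lra. }
assert (Hcp : critical_points a h1 h2 h3 h4) by (constructor; assumption || lra).
split; [exists h1 | exists h3]; (split; [lra|]);
  (split; [unfold dA; rewrite ?K1, ?K3; apply exp_ln, Ha|]).
(* [fib_b] rises from [b] at [x1] to its critical value [dB h1]; likewise from [x3] to [h3]
   below. *)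
- rewrite <- (fib_b_critical a h1) by (assumption || lra). rewrite <- B1.
  apply fib_b_increasing; try lra.
  intros x Hx. apply (jac_piece1 _ _ _ _ _ x Hcp). lra.
- rewrite <- (fib_b_critical a h3) by (assumption || lra). rewrite <- B3.
  apply fib_b_increasing; try lra.
  intros x Hx. apply (jac_piece3 _ _ _ _ _ x Hcp). lra.
Qed.

(** * Identification of [E3] with the region, and the theorem *)

Lemma five_roots_of_E3 (a b : R) : E3 (a, b) -> five_roots a b.
Proof.
intros (l & Hnd & Hlen & Hl). exists l. split; [exact Hnd|]. split; [exact Hlen|].
intros p Hp. apply (proj1 (Forall_forall _ _) Hl) in Hp.
destruct Hp as (Hpos & [Hroot _] & _). split; assumption.
Qed.

Lemma E3_iff_below (a b : R) :
  E3 (a, b) <-> below_upper_arcs a b /\ below_upper_arcs b a.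
Proof.
split.
- intros H. apply five_roots_of_E3 in H.
  split; apply below_upper_arcs_of_five_roots; [|apply five_roots_sym]; exact H.
- intros [H1 H2]. destruct (exactly_five_of_below a b H1 H2) as [l Hl].
  exact (E3_of_exactly_five a b l Hl).
Qed.

Lemma E3_diagonal (a : R) : star_center <= a <= 44/31 -> E3 (a, a).
Proof. intros Ha. apply E3_iff_below. split; apply diagonal_below_upper_arcs, Ha. Qed.

Theorem theorem1p5 :
  (exists ab, E3 ab) /\ star_convex E3 /\
  E3 (44/31, 44/31) /\
  (exists l : Datatypes.list (R * R)%type, NoDup l /\ length l = 5%nat /\
     (forall p, (in_pos_quadrant p /\ is_root (44/31) (44/31) p) <-> In p l) /\
     List.Forall (non_degenerate (44/31) (44/31)) l).
Proof.
assert (Hc : star_center <= 44/31) by (unfold star_center; pose proof dA_1_13; lra).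
split; [|split; [|split]].
- exists (44/31, 44/31). apply E3_diagonal. lra.
(* The centre is on the diagonal, so one star lemma serves both (a, b) and its reflection (b, a). *)
- exists (star_center, star_center). split; [apply E3_diagonal; lra|].
  intros [a b] H t Ht. simpl fst; simpl snd.
  apply E3_iff_below in H. destruct H as [H1 H2].
  apply E3_iff_below. split; apply below_upper_arcs_star; try assumption.
  + exact (abscissa_lower_bound a b H1 H2).
  + exact (abscissa_lower_bound b a H2 H1).
- apply E3_diagonal. lra.
- apply exactly_five_of_below; apply diagonal_below_upper_arcs; lra.
Qed.
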